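(* Let $N\ge5$ and let $(\mathbf g,\psi)$ be a perturbed global solution with sufficiently small $\mathring\varepsilon$ (as described in the context). Then, with $C>0$ depending only on $N$ and the FLRW background, the norm of the gradient of the scalar field satisfies $$\big\|-(e_0\psi)^2+(e_I\psi)e_I\psi-(e_I^a)^\infty(x)(e_I^b)^\infty(x)\,\partial_a\psi^\infty(x)\,\partial_b\psi^\infty(x)\,e^{-2Ht}\big\|_{C^{N-5}(\Sigma_t)}\le Ce^{-4Ht}\qquad\text{for all }t\in[0,+\infty),$$ where $\psi^\infty\in C^{N-4}(\mathbb T^3)$ and $(e_I^a)^\infty\in C^{N-4}(\mathbb T^3)$ are the limits $\psi^\infty=\lim_{t\to+\infty}\psi$ and $(e^a_I)^\infty=\lim_{t\to+\infty}e^{Ht}e^a_I$. In particular, if $x\in\mathbb T^3$ is not a critical point of the limit function $\psi^\infty:\mathbb T^3\to\mathbb R$, then the spacetime gradient $\mathrm{grad}\,\psi(t,x)$ is spacelike for all $t$ sufficiently large (how large depending on $x$).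
   Context: Conventions. $\Lambda>0$ is fixed and $H=\sqrt{\Lambda/3}$. Indices $i,j,a,b,I,J,B,C,D,\dots$ range over $\{1,2,3\}$ and Greek indices over $\{0,1,2,3\}$; repeated indices are summed; lower-case Latin indices are coordinate indices, capital ones refer to a spatial orthonormal frame and are never raised. Equations and data. The Einstein-massless-scalar field system for a 4-dimensional Lorentzian metric $\mathbf g$ and a scalar field $\psi$ is $\mathbf{Ric}_{\mu\nu}=\Lambda\mathbf g_{\mu\nu}+\partial_\mu\psi\,\partial_\nu\psi$, $\square_{\mathbf g}\psi=0$. Initial data are $(\Sigma_0=\mathbb T^3,\mathring g,\mathring k,\mathring\psi,\mathring\varphi)$, with $\mathring g$ a Riemannian metric, $\mathring k$ a symmetric 2-tensor (second fundamental form) and $\mathring\psi,\mathring\varphi$ functions (initial values of $\psi$ and of its derivative along the future unit normal), satisfying the constraints $\mathring R-|\mathring k|^2+(\mathrm{tr}\mathring k)^2=2\Lambda+\mathring\varphi^2+|\mathring\nabla\mathring\psi|^2$ and $\mathring{\mathrm{div}}\,\mathring k-d\,\mathrm{tr}\mathring k=-\mathring\varphi\mathring\nabla\mathring\psi$ (operations with respect to $\mathring g$). To such data corresponds a unique (up to isometry) maximal development $(\mathcal M,\mathbf g,\psi)$, in which $\Sigma_0$ is embedded as a Cauchy hypersurface, identified with $\{t=0\}$. FLRW background. On $\mathbb R\times\mathbb T^3$: $\mathbf g_{FLRW}=-dt^2+a^2(t)\sum_{i=1}^3(dx^i)^2$, $\psi_{FLRW}(t)=\mathring\psi_{FLRW}+\mathring\varphi_{FLRW}\int_0^t\frac{\mathring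 a^3}{a^3(\tau)}d\tau$, with $a(t)=\mathring a\big(\sqrt{\tfrac{\mathring\varphi_{FLRW}^2}{2\Lambda}+1}\,\sinh(\sqrt{3\Lambda}t)+\cosh(\sqrt{3\Lambda}t)\big)^{1/3}$, where $\mathring a>0$, $\mathring\psi_{FLRW},\mathring\varphi_{FLRW}\in\mathbb R$ are fixed. Its reduced variables are $(k_{IJ})_{FLRW}=-\delta_{IJ}\frac{\partial_ta}{a}$ (so $\mathrm{tr}k_{FLRW}=-3\frac{\partial_ta}{a}$), $(\gamma_{IJB})_{FLRW}=0$, $n_{FLRW}=1$, $(e^i_I)_{FLRW}=\delta^i_Ia(t)^{-1}$, $(e_0\psi)_{FLRW}=\partial_t\psi_{FLRW}$, $(e_I\psi)_{FLRW}=0$. Gauge and reduced variables. The metric is written $\mathbf g=-n^2dt^2+g_{ij}dx^idx^j$ (zero shift), with $\Sigma_t=\{t\}\times\mathbb T^3$, lapse $n$, induced Riemannian metric $g$ with Levi-Civita connection $\nabla$, and globally defined coordinate fields $\partial_1,\partial_2,\partial_3$ on $\mathbb T^3$. The time function is normalized by $n-1=\mathrm{tr}k_{FLRW}-\mathrm{tr}k$. The frame $e_0=n^{-1}\partial_t$, $e_I=e_I^i\partial_i$ is $\mathbf g$-orthonormal, with $e_I$ tangent to $\Sigma_t$ and Fermi propagated: $\mathbf D_{e_0}e_I=n^{-1}(e_In)e_0$, where $\mathbf D$ is the Levi-Civita connection of $\mathbf g$; on $\Sigma_0$, $e_1,e_2,e_3$ is obtained from $\partial_1,\partial_2,\partial_3$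 by the Gram-Schmidt process. Set $k_{IJ}=-\mathbf g(\mathbf D_{e_I}e_0,e_J)=k_{JI}$ and $\gamma_{IJB}=g(\nabla_{e_I}e_J,e_B)=-\gamma_{IBJ}$. The differences are $\widehat k_{IJ}=k_{IJ}-\frac13\delta_{IJ}\mathrm{tr}k$ (which equals $k_{IJ}-(k_{IJ})_{FLRW}+\frac13\delta_{IJ}(n-1)$), $\widehat n=n-1$, $\widehat\gamma_{IJB}=\gamma_{IJB}$, $\widehat e^i_I=e^i_I-(e^i_I)_{FLRW}$, $\widehat\psi=\psi-\psi_{FLRW}$, $\widehat{e_0\psi}=e_0\psi-\partial_t\psi_{FLRW}$, $\widehat{e_I\psi}=e_I\psi$. The spacetime gradient is $\mathrm{grad}\,\psi=-(e_0\psi)e_0+(e_I\psi)e_I$, so $\mathbf g(\mathrm{grad}\psi,\mathrm{grad}\psi)=-(e_0\psi)^2+(e_I\psi)e_I\psi$. Norms. $\|v\|_{L^2(\Sigma_t)}^2=\int_{\Sigma_t}v^2(t,x)\,dx^1dx^2dx^3$, $\|v\|^2_{H^M(\Sigma_t)}=\sum_{|\iota|\le M}\|\partial^\iota v\|^2_{L^2(\Sigma_t)}$, $\|v\|_{C^M(\Sigma_t)}=\sum_{|\iota|\le M}\|\partial^\iota v\|_{C^0(\Sigma_t)}$, where $\iota$ is a spatial multi-index and $\partial^\iota$ differentiates with respect to $\partial_1,\partial_2,\partial_3$. For the indexed variables $\widehat k,\widehat\gamma,\widehat e$ and $\widehat{e\psi}=(\widehat{e_\mu\psi})_{\mu=0}^3$,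 the squared norm is the sum of the squared norms of the components. The perturbed global solution. Set $\mathring\varepsilon^2:=\|\widehat k\|_{H^N(\Sigma_0)}^2+\|\widehat\gamma\|_{H^N(\Sigma_0)}^2+\|\widehat e\|_{H^N(\Sigma_0)}^2+\|\widehat n\|_{H^N(\Sigma_0)}^2+\|\widehat{e\psi}\|_{H^N(\Sigma_0)}^2+\|\widehat\psi\|_{H^N(\Sigma_0)}^2$. The solution considered is the maximal solution of data with $\mathring\varepsilon$ sufficiently small (depending on $N$ and the FLRW background); it exists for all $t\in[0,+\infty)$ in the gauge with zero shift, $\mathbf g=-n^2dt^2+g_{ij}dx^idx^j$, time function normalized by $n-1=\mathrm{tr}k_{FLRW}-\mathrm{tr}k$, and Fermi propagated orthonormal frame $e_0=n^{-1}\partial_t$, $e_I=e_I^i\partial_i$, and satisfies, with $C$ depending only on $N$ and the FLRW background, for all $t\ge0$: $e^{2Ht}\{\|\widehat k\|_{H^N(\Sigma_t)}^2+\|\widehat\gamma\|_{H^N(\Sigma_t)}^2+\|\widehat e\|_{H^N(\Sigma_t)}^2+e^{Ht}\|\widehat n\|_{H^N(\Sigma_t)}^2+\|\widehat{e\psi}\|_{H^N(\Sigma_t)}^2\}\le C\mathring\varepsilon^2$; $\|\widehat k\|_{C^{N-4}(\Sigma_t)}+\|\widehat n\|_{C^{N-4}(\Sigma_t)}+\|\widehat{e_0\psi}\|_{C^{N-4}(\Sigma_t)}\le C\mathring\varepsilon e^{-2Ht}$; and $\|\psi-\psi^\infty\|_{C^{N-4}(\Sigma_t)}\le Ce^{-2Ht}$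 for a limit function $\psi^\infty\in C^{N-4}(\mathbb T^3)$. The limit $(e_I^i)^\infty$ is defined as $(e_I^i)^\infty(x):=(\widehat e_I^i)^\infty(x)+\delta_I^i\,\mathring a^{-1}\big(\frac12\sqrt{\frac{\mathring\varphi_{FLRW}^2}{2\Lambda}+1}+\frac12\big)^{-1/3}$, where $(\widehat e^i_I)^\infty=\lim_{t\to+\infty}e^{Ht}\widehat e^i_I$ in $C^{N-4}(\mathbb T^3)$, which satisfies $\|\widehat e_I^i-(\widehat e_I^i)^\infty e^{-Ht}\|_{C^{N-4}(\Sigma_t)}\le C\mathring\varepsilon e^{-3Ht}$. *)

(* Defs.v *)
From HB Require Import structures.
From mathcomp Require Import all_boot all_order all_algebra.
From mathcomp Require Import all_classical all_reals all_analysis.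

Set Implicit Arguments.
Unset Strict Implicit.
Unset Printing Implicit Defensive.

Import Order.TTheory GRing.Theory Num.Theory.
Import numFieldNormedType.Exports.

Local Open Scope classical_set_scope.
Local Open Scope ring_scope.

Section calculus.
Context {R : realType} {d : nat}.
Implicit Types (f : 'rV[R]_d -> R) (G : 'rV[R]_d -> 'M[R]_d).
Implicit Types (X Y : 'rV[R]_d -> 'rV[R]_d) (p u v : 'rV[R]_d).

Definition pd (i : 'I_d) f : 'rV[R]_d -> R :=
  fun p => 'D_(delta_mx 0 i) (f : 'rV[R]_d -> R^o) p.

(* pds [:: i; j; ...] f is d_i d_j ... f *)
Definition pds (s : seq 'I_d) f : 'rV[R]_d -> R := foldr pd f s.

Definition class_C (M : nat) f : Prop :=
  forall s : seq 'I_d,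
    ((size s <= M)%N -> continuous (pds s f : 'rV[R]_d -> R^o)) /\
    ((size s < M)%N -> forall i p,
       derivable (pds s f : 'rV[R]_d -> R^o) p (delta_mx 0 i)).

Definition dot G p u v : R := \sum_i \sum_j G p i j * u 0 i * v 0 j.

(* Gamma^l_{ij} *)
Definition christoffel G (l i j : 'I_d) p : R :=
  2^-1 * \sum_m invmx (G p) l m *
    (pd i (fun q => G q m j) p + pd j (fun q => G q m i) p
     - pd m (fun q => G q i j) p).

(* R^r_{s m n}, with the sign for which round spheres have positive Ricci
   curvature *)
Definition riemann G (r s m n : 'I_d) p : R :=
  pd m (christoffel G r n s) p - pd n (christoffel G r m s) p
  + \sum_l (christoffel G r m l p * christoffel G l n s p
            - christoffel G r n l p * christoffel G l m s p).

Definition ricci G (i j : 'I_d) p : R := \sum_r riemann G r i r j p.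

Definition scalar_curvature G p : R :=
  \sum_i \sum_j invmx (G p) i j * ricci G i j p.

(* Levi-Civita derivative of Y along X *)
Definition cov G X Y : 'rV[R]_d -> 'rV[R]_d := fun p =>
  \row_l \sum_m X p 0 m *
    (pd m (fun q => Y q 0 l) p + \sum_j christoffel G l m j p * Y p 0 j).

Definition box G f p : R :=
  \sum_i \sum_j invmx (G p) i j *
    (pd i (pd j f) p - \sum_l christoffel G l i j p * pd l f p).

Definition grad G f : 'rV[R]_d -> 'rV[R]_d := fun p =>
  \row_i \sum_j invmx (G p) i j * pd j f p.

Definition along X f p : R := \sum_i X p 0 i * pd i f p.

End calculus.

(* The torus is R^3 / Z^3: functions on it are 1-periodic functions on 'rV_3,
   and integrals are taken over the unit cube. *)
Section torus.
Context {R : realType}.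
Implicit Types (f v w : 'rV[R]_3 -> R).

Definition t3_periodic (T : Type) (f : 'rV[R]_3 -> T) : Prop :=
  forall (i : 'I_3) x, f (x + delta_mx 0 i) = f x.

Local Notation mR := (measurableTypeR R).
Local Notation mu := (@lebesgue_measure R).

Definition vec3 (q : mR * mR * mR) : 'rV[R]_3 :=
  \row_(i < 3) nth (0 : R) [:: q.1.1; q.1.2; q.2] i.

Definition cube : set (mR * mR * mR)%type :=
  (`[0, 1]%classic `*` `[0, 1]%classic) `*` `[0, 1]%classic.

Definition leb2 : set (mR * mR)%type -> \bar R := (mu \x mu)%E.

HB.instance Definition _ := Measure.copy leb2 (mu \x mu)%E.

(* The library's sigma-finite structure on product measures is not inferred
   here, and Fubini's theorem for leb3 needs it. *)
Lemma leb2_sigma_finite : sigma_finite setT leb2.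
Proof.
have /sigma_finiteP[F [TF ndF Foo]] := sigma_finiteT mu.
exists (fun n => F n `*` F n).
  rewrite -setXTT TF predeqE => -[x y]; split.
    move=> [/= [n _ Fnx] [k _ Fky]]; exists (maxn n k) => //; split.
    - by move: x Fnx; exact/subsetPset/ndF/leq_maxl.
    - by move: y Fky; exact/subsetPset/ndF/leq_maxr.
  by move=> [n _ []/= ? ?]; split; exists n.
move=> k; have [mF foo] := Foo k; split; first exact: measurableX.
have -> : leb2 (F k `*` F k) = (mu (F k) * mu (F k))%E.
  exact: product_measure1E.
by rewrite lte_mul_pinfty// ge0_fin_numE.
Qed.

HB.instance Definition _ :=
  Measure_isSigmaFinite.Build _ _ _ leb2 leb2_sigma_finite.

Definition leb3 : {measure set (mR * mR * mR)%type -> \bar R} :=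
  (leb2 \x mu)%E.

Definition torus_int f : R := Rintegral leb3 cube (f \o vec3).

Definition L2sq f : \bar R :=
  (\int[leb3]_(q in cube) ((f (vec3 q)) ^+ 2)%:E)%E.

Definition in_L2 f : Prop :=
  measurable_fun cube (f \o vec3) /\ (L2sq f < +oo)%E.

(* Multi-indices of length 3 with entries at most M; those of order at most M
   are the ones with mlen i <= M. *)
Definition mindex (M : nat) := {ffun 'I_3 -> 'I_M.+1}.
Definition mlen M (i : mindex M) : nat := (\sum_j i j)%N.
Definition mpd M (i : mindex M) f : 'rV[R]_3 -> R :=
  pds (flatten [seq nseq (i j) j | j <- enum 'I_3]) f.

(* +oo when f is not of class C^M *)
Definition Cnorm (M : nat) f : \bar R :=
  if `[< class_C M f >] then
    (\sum_(i : mindex M | (mlen i <= M)%N)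
       ereal_sup [set (`|mpd i f x|)%:E | x in [set: 'rV[R]_3]])%E
  else +oo%E.

(* w is the weak derivative of order i of v on the torus *)
Definition weak_mpd M (i : mindex M) v w : Prop :=
  [/\ in_L2 v, in_L2 w &
      forall phi, t3_periodic phi -> (forall m, class_C m phi) ->
        torus_int (fun x => v x * mpd i phi x) =
        (-1) ^+ mlen i * torus_int (fun x => w x * phi x)].

(* The squared H^M norm. A weak derivative is unique almost everywhere, so each
   infimum is over at most one value; it is +oo when there is no
   square-integrable weak derivative. *)
Definition Hsq (M : nat) v : \bar R :=
  (\sum_(i : mindex M | (mlen i <= M)%N)
     ereal_inf [set L2sq w | w in weak_mpd i v])%E.

End torus.

Section flrw.
Context {R : realType}.

Record flrw := Flrw { Lam : R; a_ini : R; psi_ini : R; phi_ini : R }.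

Variable B : flrw.

Definition hubble : R := Num.sqrt (Lam B / 3).

Definition sinh (s : R) : R := (expR s - expR (- s)) / 2.
Definition cosh (s : R) : R := (expR s + expR (- s)) / 2.

Definition flrw_coef : R := Num.sqrt (phi_ini B ^+ 2 / (2 * Lam B) + 1).

Definition flrw_a (t : R) : R :=
  a_ini B * (flrw_coef * sinh (Num.sqrt (3 * Lam B) * t)
             + cosh (Num.sqrt (3 * Lam B) * t)) `^ (3^-1).

(* int_0^t f, with the usual sign for t < 0 *)
Definition oint (f : R -> R) (t : R) : R :=
  if 0 <= t then \int[lebesgue_measure]_(s in `[0, t]) f s
  else - \int[lebesgue_measure]_(s in `[t, 0]) f s.

Definition flrw_psi (t : R) : R :=
  psi_ini B + phi_ini B * oint (fun s => a_ini B ^+ 3 / flrw_a s ^+ 3) t.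

Definition flrw_dtpsi (t : R) : R := derive1 (flrw_psi : R -> R^o) t.

Definition flrw_k (I J : 'I_3) (t : R) : R :=
  - (I == J)%:R * (derive1 (flrw_a : R -> R^o) t / flrw_a t).

Definition flrw_trk (t : R) : R := \sum_I flrw_k I I t.

Definition flrw_e (I i : 'I_3) (t : R) : R := (I == i)%:R * (flrw_a t)^-1.

(* limit of e^{Ht} / a(t) *)
Definition flrw_einf : R :=
  (a_ini B)^-1 * (2^-1 * flrw_coef + 2^-1) `^ (- 3^-1).

End flrw.
Arguments flrw R : clear implicits.

(* Points of spacetime are row vectors (t, x) : 'rV_(1 + 3). *)
Section spacetime.
Context {R : realType}.

Definition pt (t : R) (x : 'rV[R]_3) : 'rV[R]_(1 + 3) := row_mx t%:M x.

Definition time_ix : 'I_(1 + 3) := lshift 3 ord0.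
Definition space_ix (i : 'I_3) : 'I_(1 + 3) := rshift 1 i.

(* The fields are given on R x T^3, but only their restrictions to t >= 0 are
   ever constrained beyond differentiability: being of class C^k on
   [0, +oo) x T^3 means having an extension of class C^k. *)
Record spacetime := Spacetime {
  lapse : 'rV[R]_(1 + 3) -> R;
  smetric : 'rV[R]_(1 + 3) -> 'M[R]_3;
  sframe : 'I_3 -> 'rV[R]_(1 + 3) -> 'rV[R]_3; (* sframe I p 0 i is e_I^i *)
  sfield : 'rV[R]_(1 + 3) -> R }.

Record data := Data {
  g_ini : 'rV[R]_3 -> 'M[R]_3;
  k_ini : 'rV[R]_3 -> 'M[R]_3;
  psi_dat : 'rV[R]_3 -> R;
  phi_dat : 'rV[R]_3 -> R }.

Definition riemannian (g : 'M[R]_3) : Prop :=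
  g^T = g /\ forall u : 'rV[R]_3, u != 0 -> 0 < (u *m g *m u^T) 0 0.

Section constraints.
Variables (L : R) (D : data).
Let g := g_ini D.
Let k := k_ini D.
Let ginv x := invmx (g x).

Definition data_trk (x : 'rV[R]_3) : R := \sum_i \sum_j ginv x i j * k x i j.

Definition data_ksq (x : 'rV[R]_3) : R :=
  \sum_i \sum_j \sum_a \sum_b ginv x i a * ginv x j b * k x i j * k x a b.

(* nabla_a k_{ij} *)
Definition data_cov_k (a i j : 'I_3) (x : 'rV[R]_3) : R :=
  pd a (fun y => k y i j) x
  - \sum_c (christoffel g c a i x * k x c j + christoffel g c a j x * k x i c).

Definition data_div_k (j : 'I_3) (x : 'rV[R]_3) : R :=
  \sum_i \sum_a ginv x a i * data_cov_k a i j x.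

Definition initial_data : Prop :=
  [/\ [/\ t3_periodic g, t3_periodic k, t3_periodic (psi_dat D) &
          t3_periodic (phi_dat D)],
      [/\ forall i j, class_C 2 (fun x => g x i j),
          forall i j, class_C 1 (fun x => k x i j),
          class_C 2 (psi_dat D) & class_C 1 (phi_dat D)],
      forall x, riemannian (g x) /\ (k x)^T = k x,
      forall x, scalar_curvature g x - data_ksq x + data_trk x ^+ 2 =
        2 * L + phi_dat D x ^+ 2
        + dot g x (grad g (psi_dat D) x) (grad g (psi_dat D) x) &
      forall j x, data_div_k j x - pd j data_trk x =
        - phi_dat D x * pd j (psi_dat D) x].

End constraints.

Section gauge.
Variable S : spacetime.
Let n := lapse S.
Let psi := sfield S.

Definition stmetric (p : 'rV[R]_(1 + 3)) : 'M[R]_(1 + 3) :=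
  block_mx (- n p ^+ 2)%:M 0 0 (smetric S p).

Definition slice_metric (t : R) (x : 'rV[R]_3) : 'M[R]_3 :=
  smetric S (pt t x).

Definition e0 (p : 'rV[R]_(1 + 3)) : 'rV[R]_(1 + 3) := row_mx ((n p)^-1)%:M 0.

Definition eI (I : 'I_3) (p : 'rV[R]_(1 + 3)) : 'rV[R]_(1 + 3) :=
  row_mx 0 (sframe S I p).

Definition coord_field (i : 'I_(1 + 3)) (p : 'rV[R]_(1 + 3)) : 'rV[R]_(1 + 3) :=
  delta_mx 0 i.

Definition kf (I J : 'I_3) (p : 'rV[R]_(1 + 3)) : R :=
  - dot stmetric p (cov stmetric (eI I) e0 p) (eI J p).

Definition trk (p : 'rV[R]_(1 + 3)) : R := \sum_I kf I I p.

Definition slice_frame (t : R) (I : 'I_3) (x : 'rV[R]_3) : 'rV[R]_3 :=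
  sframe S I (pt t x).

(* gamma_{IJB}, with the connection of the slice *)
Definition gam (I J B : 'I_3) (t : R) (x : 'rV[R]_3) : R :=
  dot (slice_metric t) x
    (cov (slice_metric t) (slice_frame t I) (slice_frame t J) x)
    (slice_frame t B x).

Definition gram_schmidt (g : 'rV[R]_3 -> 'M[R]_3)
    (e : 'I_3 -> 'rV[R]_3 -> 'rV[R]_3) : Prop :=
  forall (I : 'I_3) x,
    let u := delta_mx 0 I
             - \sum_(J < 3 | (J < I)%N) dot g x (delta_mx 0 I) (e J x) *: e J x
    in e I x = (Num.sqrt (dot g x u u))^-1 *: u.

(* For solutions with data in H^N, N >= 5, the lapse need not be twice
   continuously differentiable in t; second time derivatives of the lapse
   cancel in the Ricci tensor of stmetric. *)
Definition regular : Prop :=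
  [/\ forall (i : 'I_3) (p : 'rV[R]_(1 + 3)),
        let q := p + delta_mx 0 (space_ix i) in
        [/\ n q = n p, smetric S q = smetric S p,
            psi q = psi p & forall I, sframe S I q = sframe S I p],
      class_C 1 n /\ forall i : 'I_3, class_C 1 (pd (space_ix i) n),
      forall i j, class_C 2 (fun p => smetric S p i j),
      class_C 2 psi &
      forall I i, class_C 1 (fun p => sframe S I p 0 i)].

Definition einstein_scalar (L : R) : Prop :=
  forall t x, 0 <= t ->
    (forall mu nu, ricci stmetric mu nu (pt t x) =
       L * stmetric (pt t x) mu nu + pd mu psi (pt t x) * pd nu psi (pt t x))
    /\ box stmetric psi (pt t x) = 0.

Definition attains (D : data) : Prop :=
  forall x,
    [/\ smetric S (pt 0 x) = g_ini D x,
        forall i j, k_ini D x i j =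
          - dot stmetric (pt 0 x)
              (cov stmetric (coord_field (space_ix i)) e0 (pt 0 x))
              (coord_field (space_ix j) (pt 0 x)),
        psi (pt 0 x) = psi_dat D x &
        along e0 psi (pt 0 x) = phi_dat D x].

Definition in_gauge (B : flrw R) : Prop :=
  [/\ forall t x, 0 <= t -> n (pt t x) - 1 = flrw_trk B t - trk (pt t x),
      forall t x, 0 <= t ->
        [/\ dot stmetric (pt t x) (e0 (pt t x)) (e0 (pt t x)) = -1,
            forall I, dot stmetric (pt t x) (e0 (pt t x)) (eI I (pt t x)) = 0 &
            forall I J, dot stmetric (pt t x) (eI I (pt t x)) (eI J (pt t x))
                        = (I == J)%:R],
      forall t x I, 0 <= t ->
        cov stmetric e0 (eI I) (pt t x) =
          ((n (pt t x))^-1 * along (eI I) n (pt t x)) *: e0 (pt t x) &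
      gram_schmidt (slice_metric 0) (slice_frame 0)].

Definition development (B : flrw R) (D : data) : Prop :=
  [/\ regular,
      forall t x, 0 <= t ->
        0 < n (pt t x) /\ riemannian (smetric S (pt t x)),
      einstein_scalar (Lam B), attains D & in_gauge B].

Section differences.
Variable B : flrw R.

Definition hat_k (I J : 'I_3) (t : R) (x : 'rV[R]_3) : R :=
  kf I J (pt t x) - 3^-1 * (I == J)%:R * trk (pt t x).
Definition hat_n (t : R) (x : 'rV[R]_3) : R := n (pt t x) - 1.
Definition hat_e (I i : 'I_3) (t : R) (x : 'rV[R]_3) : R :=
  sframe S I (pt t x) 0 i - flrw_e B I i t.
Definition hat_psi (t : R) (x : 'rV[R]_3) : R :=
  psi (pt t x) - flrw_psi B t.
Definition hat_e0psi (t : R) (x : 'rV[R]_3) : R :=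
  along e0 psi (pt t x) - flrw_dtpsi B t.
Definition hat_eIpsi (I : 'I_3) (t : R) (x : 'rV[R]_3) : R :=
  along (eI I) psi (pt t x).

Local Open Scope ereal_scope.

Definition Hsq_k N t : \bar R := \sum_I \sum_J Hsq N (hat_k I J t).
Definition Hsq_gam N t : \bar R := \sum_I \sum_J \sum_K Hsq N (gam I J K t).
Definition Hsq_e N t : \bar R := \sum_I \sum_i Hsq N (hat_e I i t).
Definition Hsq_epsi N t : \bar R :=
  Hsq N (hat_e0psi t) + \sum_I Hsq N (hat_eIpsi I t).

Definition Cnorm_k M t : \bar R :=
  sqrte (\sum_I \sum_J Cnorm M (hat_k I J t) ^+ 2).

Definition initial_size N : \bar R :=
  Hsq_k N 0 + Hsq_gam N 0 + Hsq_e N 0 + Hsq N (hat_n 0) + Hsq_epsi N 0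
  + Hsq N (hat_psi 0).

End differences.

End gauge.

(* (e_I^i)^infty, in terms of the limit of e^{Ht} \hat e_I^i *)
Definition einf (B : flrw R) (ehinf : 'I_3 -> 'I_3 -> 'rV[R]_3 -> R)
    (I i : 'I_3) (x : 'rV[R]_3) : R :=
  ehinf I i x + (I == i)%:R * flrw_einf B.

(* A solution on [0, +oo) x T^3 whose data have initial size eps ^ 2, together
   with the global estimates, with constant C, and the limits psinf of psi and
   ehinf of e^{Ht} \hat e. *)
Definition perturbed_global_solution (N : nat) (B : flrw R) (C eps : R)
    (D : data) (S : spacetime) (psinf : 'rV[R]_3 -> R)
    (ehinf : 'I_3 -> 'I_3 -> 'rV[R]_3 -> R) : Prop :=
  let H := hubble B in
  [/\ initial_data (Lam B) D /\ development S B D,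
      0 <= eps /\ initial_size S B N = (eps ^+ 2)%:E,
      forall t, 0 <= t ->
        ((expR (2 * H * t))%:E *
           (Hsq_k S N t + Hsq_gam S N t + Hsq_e S B N t
            + (expR (H * t))%:E * Hsq N (hat_n S t) + Hsq_epsi S B N t)
         <= (C * eps ^+ 2)%:E)%E /\
        (Cnorm_k S (N - 4) t + Cnorm (N - 4) (hat_n S t)
           + Cnorm (N - 4) (hat_e0psi S B t)
         <= (C * eps * expR (- 2 * H * t))%:E)%E,
      [/\ t3_periodic psinf, class_C (N - 4) psinf &
          forall t, 0 <= t ->
            (Cnorm (N - 4) (fun x => sfield S (pt t x) - psinf x)%R
             <= (C * expR (- 2 * H * t))%:E)%E] &
      forall I i,
        [/\ t3_periodic (ehinf I i), class_C (N - 4) (ehinf I i),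
            Cnorm (N - 4)
                (fun x => expR (H * t) * hat_e S B I i t x - ehinf I i x)
              @[t --> +oo] --> 0%E &
            forall t, 0 <= t ->
              (Cnorm (N - 4)
                 (fun x => hat_e S B I i t x - ehinf I i x * expR (- H * t))%R
               <= (C * eps * expR (- 3 * H * t))%:E)%E]].

End spacetime.
Arguments spacetime R : clear implicits.
Arguments data R : clear implicits.

(* Main.v *)
(* Idea. Split the frame as e_I^a = q (e_I^a)^infty + O(q^3) and the field as
   psi = psi^infty + O(q^2), where q = e^{-Ht}; together with e_0 psi = O(q^2)
   and the Leibniz rule in C^{N-5} this gives the expansion of the norm of the
   gradient up to O(q^4). The constants are uniform because a Sobolev
   inequality on the torus turns the H^N bounds on the initial data into C^{N-4}
   bounds on the limits; it also makes (e_I^a)^infty a small perturbation of a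
   multiple of the identity, so that the leading term is positive away from the
   critical points of psi^infty.

   The Sobolev inequality is proved by testing the weak derivatives against the
   products of the one-dimensional kernels c_n cos^{2n}(pi x) = 1 + W_n'(x),
   where W_n is periodic and |W_n| <= 1. Expanding the product of the 1 + W_n'
   and integrating by parts leaves only test functions bounded by 1. The same
   kernels show that mixed partial derivatives commute. *)
Require Import Defs.
From mathcomp Require Import all_boot all_order all_algebra.
From mathcomp Require Import all_classical all_reals all_analysis.
From mathcomp Require Import measurable_realfun ring lra zify.
Set Implicit Arguments.
Unset Strict Implicit.
Unset Printing Implicit Defensive.
Import Order.TTheory GRing.Theory Num.Theory.
Import numFieldNormedType.Exports.
Local Open Scope classical_set_scope.
Local Open Scope ring_scope.

(** The constant [C] is fixed before the solution, while the hypotheses bound only the distance of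
    [psinf] and [ehinf] from the solution, not the limits themselves. The missing bounds are
    obtained at t = 0, where the fields have known H^N size. That these fields are of class C^{N-4}
    at t = 0 follows from their finite C^{N-4} distance to the limits, so the Sobolev inequality is
    needed only as an a priori estimate for functions already of class C^M. It costs three weak
    derivatives, one per direction, and N - 4 + 3 <= N. Bounds are carried by [bounded_C], which
    admits derivatives in any order and is therefore stable under one more [pd]. In contrast [Cnorm]
    and [weak_mpd] fix one order for each multi-index; passing between the two is what requires
    mixed partial derivatives to commute. *)

(** * Calculus of C^M functions and of uniform bounds on their derivatives *)

Section class_C_calculus.
Context {R : realType} {d : nat}.
Implicit Types (f g : 'rV[R]_d -> R) (K : R).

Lemma pd_shift i f (v : 'rV[R]_d) : (forall p, f (p + v) = f p) ->
  forall p, pd i f (p + v) = pd i f p.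
Proof.
move=> fv p; rewrite /pd /derive.
set F := (X in lim (X @ _) = _); set G := (X in _ = lim (X @ _)).
suff -> : F = G by [].
by apply/funext => h; rewrite /F /G /= addrA !fv.
Qed.

Lemma pds_rcons (s : seq 'I_d) i f : pds (rcons s i) f = pds s (pd i f).
Proof. by rewrite /pds foldr_rcons. Qed.

Lemma pds_cat (s s' : seq 'I_d) f : pds (s ++ s') f = pds s (pds s' f).
Proof. by rewrite /pds foldr_cat. Qed.

Lemma class_C0 f : class_C 0 f <-> continuous (f : _ -> R^o).
Proof.
split=> [/(_ [::])[+ _]|cf s]; first exact.
split=> //; rewrite leqn0 => /nilP ->; exact: cf.
Qed.

Lemma class_CS M f : class_C M.+1 f <->
  [/\ continuous (f : _ -> R^o),
      forall i p, derivable (f : _ -> R^o) p (delta_mx 0 i) &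
      forall i, class_C M (pd i f)].
Proof.
split=> [cf|[cf df dC] s].
  split=> [|i p|i s]; [exact: (cf [::]).1|exact: (cf [::]).2|].
  have := cf (rcons s i); rewrite pds_rcons size_rcons !ltnS.
  by case.
elim/last_ind: s => [|s i _]; first by split=> // _; exact: df.
by rewrite pds_rcons size_rcons !ltnS; exact: dC.
Qed.

Lemma class_C_le M M' f : (M <= M')%N -> class_C M' f -> class_C M f.
Proof.
move=> MM' cf s; have [cs ds] := cf s; split=> sM; first exact/cs/(leq_trans sM).
exact/ds/(leq_trans sM).
Qed.

Lemma class_C_continuous M f : class_C M f -> continuous (f : _ -> R^o).
Proof. by move=> cf; apply/class_C0; exact: class_C_le cf. Qed.

Lemma class_C_pds M f (s : seq 'I_d) : (size s <= M)%N ->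
  class_C M f -> class_C (M - size s) (pds s f).
Proof.
move=> sM cf s'; rewrite -pds_cat; have [cs ds] := cf (s' ++ s).
rewrite size_cat in cs ds; split=> h; [apply: cs|apply: ds]; lia.
Qed.

Lemma class_C_pd M f i : class_C M.+1 f -> class_C M (pd i f).
Proof. by move=> /class_CS[]. Qed.

Lemma pd_cst i K : pd i (cst K : 'rV[R]_d -> R) = cst 0.
Proof. by apply/funext => p; rewrite /pd derive_cst. Qed.

Lemma pdD i f g : (forall p, derivable (f : _ -> R^o) p (delta_mx 0 i)) ->
  (forall p, derivable (g : _ -> R^o) p (delta_mx 0 i)) ->
  pd i (f \+ g) = pd i f \+ pd i g.
Proof.
by move=> df dg; apply/funext => p; rewrite /pd (deriveD (df p) (dg p)).
Qed.

Lemma pdM i f g : (forall p, derivable (f : _ -> R^o) p (delta_mx 0 i)) ->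
  (forall p, derivable (g : _ -> R^o) p (delta_mx 0 i)) ->
  pd i (f \* g) = (pd i f \* g) \+ (f \* pd i g).
Proof.
move=> df dg; apply/funext => p; rewrite /pd (deriveM (df p) (dg p)) addrC.
by congr (_ + _); exact: mulrC.
Qed.

Lemma class_C_cst M K : class_C M (cst K : 'rV[R]_d -> R).
Proof.
elim: M K => [|M IH] K; first by apply/class_C0; exact: cst_continuous.
by apply/class_CS; split=> [|i p|i]; [exact: cst_continuous|
  exact: derivable_cst|rewrite pd_cst].
Qed.

Lemma class_CD M f g : class_C M f -> class_C M g -> class_C M (f \+ g).
Proof.
elim: M f g => [|M IH] f g.
  move=> /class_C0 cf /class_C0 cg; apply/class_C0 => p.
  exact: (@cvgD _ R^o _ _ _ _ _ _ _ (cf p) (cg p)).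
move=> /class_CS[cf df dcf] /class_CS[cg dg dcg]; apply/class_CS; split.
- by move=> p; exact: (@cvgD _ R^o _ _ _ _ _ _ _ (cf p) (cg p)).
- by move=> i p; exact: derivableD.
- by move=> i; rewrite (pdD (df i) (dg i)); exact: (IH _ _ (dcf i) (dcg i)).
Qed.

Lemma class_CM M f g : class_C M f -> class_C M g -> class_C M (f \* g).
Proof.
elim: M f g => [|M IH] f g.
  move=> /class_C0 cf /class_C0 cg; apply/class_C0 => p.
  exact: (@cvgM _ _ _ _ _ _ _ _ (cf p) (cg p)).
move=> cf cg.
have /class_CS[cf0 df dcf] := cf; have /class_CS[cg0 dg dcg] := cg.
apply/class_CS; split.
- by move=> p; exact: (@cvgM _ _ _ _ _ _ _ _ (cf0 p) (cg0 p)).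
- by move=> i p; exact: derivableM.
- move=> i; rewrite (pdM (df i) (dg i)); apply: class_CD.
    exact: (IH _ _ (dcf i) (class_C_le (leqnSn M) cg)).
  exact: (IH _ _ (class_C_le (leqnSn M) cf) (dcg i)).
Qed.

Lemma class_CZ M f K : class_C M f -> class_C M (fun x => K * f x).
Proof. exact/class_CM/class_C_cst. Qed.

Lemma class_C_sum (I : Type) (r : seq I) M (f : I -> 'rV[R]_d -> R) :
  (forall i, class_C M (f i)) -> class_C M (fun x => \sum_(i <- r) f i x).
Proof.
move=> cf; elim: r => [|i r IH].
  by under eq_fun do rewrite big_nil; exact: class_C_cst.
have -> : (fun x => \sum_(j <- i :: r) f j x) =
    f i \+ (fun x => \sum_(j <- r) f j x).
  by apply/funext => x; rewrite big_cons.
exact: class_CD (cf i) IH.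
Qed.

(** The maximum form of the C^M norm, over sequences of directions instead of multi-indices: by
    [bounded_CS], sums and products can then be treated by induction on M. *)
Definition bounded_C M K f : Prop :=
  class_C M f /\ forall s x, (size s <= M)%N -> `|pds s f x| <= K.

Lemma bounded_C0 K f : bounded_C 0 K f <->
  continuous (f : _ -> R^o) /\ forall x, `|f x| <= K.
Proof.
split=> [[/class_C0 cf bf]|[cf bf]]; first by split=> // x; exact: (bf [::]).
by split=> [|s x]; [exact/class_C0|rewrite leqn0 => /nilP ->].
Qed.

Lemma bounded_CS M K f : bounded_C M.+1 K f <->
  [/\ continuous (f : _ -> R^o),
      forall i p, derivable (f : _ -> R^o) p (delta_mx 0 i),
      forall x, `|f x| <= K & forall i, bounded_C M K (pd i f)].
Proof.
split=> [[cf bf]|[cf df bf dC]].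
  have /class_CS[cf0 df dcf] := cf; split=> // [x|i]; first exact: (bf [::]).
  split=> // s x sM; rewrite -pds_rcons; apply: bf.
  by rewrite size_rcons.
split=> [|s x].
  by apply/class_CS; split; [exact: cf|exact: df|move=> i; have [] := dC i].
elim/last_ind: s => // s i _; rewrite pds_rcons size_rcons ltnS.
by have [_] := dC i; exact.
Qed.

Lemma bounded_C_le M M' K K' f : (M <= M')%N -> K' <= K ->
  bounded_C M' K' f -> bounded_C M K f.
Proof.
move=> MM' KK' [cf bf]; split; first exact: class_C_le cf.
by move=> s x sM; apply: le_trans KK'; apply: bf; exact: leq_trans MM'.
Qed.

Lemma bounded_C_ge0 M K f : bounded_C M K f -> 0 <= K.
Proof. by move=> [_ /(_ [::] 0 isT)]; exact: le_trans. Qed.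

Lemma bounded_C_pd M K f i : bounded_C M.+1 K f -> bounded_C M K (pd i f).
Proof. by move=> /bounded_CS[]. Qed.

Lemma bounded_CD M K K' f g : bounded_C M K f -> bounded_C M K' g ->
  bounded_C M (K + K') (f \+ g).
Proof.
elim: M f g => [|M IH] f g.
  move=> /bounded_C0[/class_C0 cf bf] /bounded_C0[/class_C0 cg bg].
  apply/bounded_C0; split; first exact/class_C0/class_CD.
  by move=> x; rewrite (le_trans (ler_normD _ _))// lerD.
move=> bf bg; have [ccf bf0] := bf; have [ccg bg0] := bg.
have /class_CS[_ df _] := ccf; have /class_CS[_ dg _] := ccg.
apply/bounded_CS; split.
- exact: class_C_continuous (class_CD ccf ccg).
- by move=> i p; exact: (derivableD (df i p) (dg i p)).
- move=> x; rewrite (le_trans (ler_normD _ _))// lerD//.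
    exact: (bf0 [::]).
  exact: (bg0 [::]).
- move=> i; rewrite (pdD (df i) (dg i)).
  exact: (IH _ _ (bounded_C_pd i bf) (bounded_C_pd i bg)).
Qed.

Lemma bounded_C_cst M K : bounded_C M `|K| (cst K : 'rV[R]_d -> R).
Proof.
split; first exact: class_C_cst.
elim/last_ind => [|s i IH] x sM //; rewrite pds_rcons pd_cst.
apply: le_trans (normr_ge0 _).
rewrite (_ : pds s _ = cst 0) ?normr0//.
by elim: s {IH sM} => //= j s ->; rewrite pd_cst.
Qed.

(** Each use of the Leibniz rule doubles the number of terms, whence 2 ^+ M. *)
Lemma bounded_CM M K K' f g : bounded_C M K f -> bounded_C M K' g ->
  bounded_C M (2 ^+ M * (K * K')) (f \* g).
Proof.
elim: M f g => [|M IH] f g.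
  move=> /bounded_C0[/class_C0 cf bf] /bounded_C0[/class_C0 cg bg].
  apply/bounded_C0; split; first exact/class_C0/class_CM.
  by move=> x; rewrite mul1r normrM ler_pM.
move=> bf bg; have K0 := bounded_C_ge0 bf; have K'0 := bounded_C_ge0 bg.
have [ccf bf0] := bf; have [ccg bg0] := bg.
have /class_CS[_ df _] := ccf; have /class_CS[_ dg _] := ccg.
apply/bounded_CS; split.
- exact: class_C_continuous (class_CM ccf ccg).
- by move=> i p; exact: (derivableM (df i p) (dg i p)).
- move=> x; rewrite normrM (@le_trans _ _ (K * K'))//.
    by rewrite ler_pM//; [exact: (bf0 [::])|exact: (bg0 [::])].
  by rewrite ler_peMl ?mulr_ge0// exprn_ege1// ler1n.
- move=> i; rewrite (pdM (df i) (dg i)) exprS -mulrA mulr_natl mulr2n.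
  apply: bounded_CD.
    exact: (IH _ _ (bounded_C_pd i bf) (bounded_C_le (leqnSn M) (lexx _) bg)).
  exact: (IH _ _ (bounded_C_le (leqnSn M) (lexx _) bf) (bounded_C_pd i bg)).
Qed.

Lemma bounded_CZ M K K' f : bounded_C M K f ->
  bounded_C M (`|K'| * K) (fun x => K' * f x).
Proof.
move=> [cf bf]; split; first exact: class_CZ.
move=> s x sM; have -> : pds s (fun x => K' * f x) = (fun x => K' * pds s f x).
  elim: s x sM => //= i s IH x sM; rewrite IH//; last exact: ltnW.
  apply/funext => y; rewrite /pd deriveMl//.
  by have [_] := cf s; exact.
by rewrite normrM ler_wpM2l ?normr_ge0 ?bf.
Qed.

Lemma bounded_CN M K f : bounded_C M K f -> bounded_C M K (fun x => - f x).
Proof.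
move=> /(bounded_CZ (-1)); rewrite normrN1 mul1r.
by under eq_fun do rewrite mulN1r.
Qed.

Lemma bounded_CB M K K' f g : bounded_C M K f -> bounded_C M K' g ->
  bounded_C M (K + K') (f \- g).
Proof. by move=> bf bg; apply: (bounded_CD bf); exact: bounded_CN. Qed.

Lemma bounded_C_sum M m (K : 'I_m -> R) (f : 'I_m -> 'rV[R]_d -> R) :
  (forall i, bounded_C M (K i) (f i)) ->
  bounded_C M (\sum_i K i) (fun x => \sum_i f i x).
Proof.
elim: m K f => [|m IH] K f bf.
  rewrite big_ord0; under eq_fun do rewrite big_ord0.
  by have := bounded_C_cst M 0; rewrite normr0.
rewrite big_ord_recl.
have -> : (fun x => \sum_i f i x) = f ord0 \+ (fun x => \sum_i f (lift ord0 i) x).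
  by apply/funext => x; rewrite big_ord_recl.
by apply: bounded_CD; [exact: bf|exact: IH].
Qed.

End class_C_calculus.

(** * Joint measurability and Fubini arguments *)

Section caratheodory.
Context {R : realType} {d : measure_display} {T : measurableType d}.
Local Notation mR := (measurableTypeR R).

Lemma floor_quotient_cvg (x : R) :
  (Num.floor (x * n.+1%:R))%:~R / n.+1%:R @[n --> \oo] --> x.
Proof.
apply: (@squeeze_cvgr _ _ _ _ (fun n => x - n.+1%:R^-1) (fun=> x)).
- near=> n; have n0 : (0 : R) < n.+1%:R by rewrite ltr0n.
  have /andP[h1 h2] := floor_itv (x * n.+1%:R).
  rewrite ler_pdivrMr// h1 andbT ler_pdivlMr// mulrBl mulVf ?gt_eqF//.
  by rewrite lerBlDr ltW// (lt_le_trans h2)// intrD.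
- rewrite -[X in _ --> X]subr0; apply: cvgB; first exact: cvg_cst.
  exact: cvg_harmonic.
- exact: cvg_cst.
Unshelve. all: by end_near.
Qed.

(** Freezing the second variable at the grid point below it gives functions [h n] whose preimages
    are countable unions of rectangles; they converge pointwise to F by continuity in that variable.
    Applied twice, this gives measurability of continuous functions for the iterated product of
    sigma-algebras on the cube. *)
Lemma measurable_fun_caratheodory (F : T * mR -> R) :
  (forall y, measurable_fun setT (fun t => F (t, y))) ->
  (forall t, continuous ((fun y => F (t, y)) : R -> R^o)) ->
  measurable_fun setT F.
Proof.
move=> mF cF.
pose h n (q : T * mR) := F (q.1, (Num.floor (q.2 * n.+1%:R))%:~R / n.+1%:R).
apply: (@measurable_fun_cvg _ _ _ setT h) => [n _ Y mY|[t y] _].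
  rewrite setTI.
  have -> : h n @^-1` Y = \bigcup_(a : int)
      (((fun t => F (t, a%:~R / n.+1%:R)) @^-1` Y) `*`
       [set y | a%:~R <= y * n.+1%:R < (a + 1)%:~R]).
    apply/seteqP; split=> [[t y] hY|[t y] [a _] [/= hY /floor_def ay]].
      exists (Num.floor (y * n.+1%:R)) => //; split=> //=; exact: floor_itv.
    by rewrite /h /= ay.
  apply: countable_bigcupT_measurable => // a; apply: measurableX.
    by rewrite -[X in measurable X]setTI; exact: mF.
  have n0 : (0 : R) < n.+1%:R by rewrite ltr0n.
  rewrite (_ : [set _ | _] = `[a%:~R / n.+1%:R, (a + 1)%:~R / n.+1%:R[%classic).
    exact: measurable_itv.
  by apply/seteqP; split=> y /=; rewrite in_itv /= ler_pdivrMr// ltr_pdivlMr.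
apply: (@cvg_comp _ _ _ (fun n => (Num.floor (y * n.+1%:R))%:~R / n.+1%:R)
  (fun y => F (t, y))); [exact: floor_quotient_cvg|exact: cF].
Qed.

End caratheodory.

Section vanishing_slices.
Context {R : realType} {d1 d2 : measure_display}.
Context {T1 : measurableType d1} {T2 : measurableType d2}.
Variables (m1 : {sigma_finite_measure set T1 -> \bar R}).
Variables (m2 : {sigma_finite_measure set T2 -> \bar R}).
Variables (A : set T1) (B : set T2) (f : T1 * T2 -> \bar R).
Hypotheses (mA : measurable A) (mB : measurable B).
Hypothesis fi : (m1 \x m2)%E.-integrable (A `*` B) f.
Local Open Scope ereal_scope.

(** Fubini for the extension by zero. Both orders of integration are needed, as the direction of a
    derivative may lie in either factor of the product. *)
Lemma integral_slice1_0 :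
  (forall x, A x -> \int[m2]_(y in B) f (x, y) = 0) ->
  \int[m1 \x m2]_(q in A `*` B) f q = 0.
Proof.
move=> f0; rewrite integral_mkcond -integral12_prod_meas1; last first.
  by apply/(integrable_mkcond f) => //; exact: measurableX.
apply: integral0_eq => x _; rewrite /fubini_F.
have [Ax|nAx] := pselect (A x).
  rewrite -[RHS](f0 x Ax) [RHS]integral_mkcond; apply: eq_integral => y _.
  rewrite !patchE; congr (if _ then _ else _).
  by apply/idP/idP => /set_mem h; apply/mem_set; [case: h|split].
apply: integral0_eq => y _; rewrite patchE ifF//.
by apply/negbTE/negP => /set_mem[].
Qed.

Lemma integral_slice2_0 :
  (forall y, B y -> \int[m1]_(x in A) f (x, y) = 0) ->
  \int[m1 \x m2]_(q in A `*` B) f q = 0.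
Proof.
move=> f0; rewrite integral_mkcond -integral21_prod_meas1; last first.
  by apply/(integrable_mkcond f) => //; exact: measurableX.
apply: integral0_eq => y _; rewrite /fubini_G.
have [By|nBy] := pselect (B y).
  rewrite -[RHS](f0 y By) [RHS]integral_mkcond; apply: eq_integral => x _.
  rewrite !patchE; congr (if _ then _ else _).
  by apply/idP/idP => /set_mem h; apply/mem_set; [case: h|split].
apply: integral0_eq => x _; rewrite patchE ifF//.
by apply/negbTE/negP => /set_mem[].
Qed.

End vanishing_slices.

Section slices.
Context {R : realType}.

Lemma is_derive_slice (V : normedModType R) (f : V -> R) (p v : V) (s : R) :
  derivable (f : V -> R^o) (p + s *: v) v ->
  is_derive s 1 ((fun r => f (p + r *: v)) : R -> R^o) ('D_v (f : V -> R^o) (p + s *: v)).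
Proof.
move=> df.
have E : (fun h : R => h^-1 *:
    (((fun r => f (p + r *: v)) \o shift s) (h *: (1 : R)) - f (p + s *: v)))
  = (fun h => h^-1 *: ((f \o shift (p + s *: v)) (h *: v) - f (p + s *: v))).
  apply/funext => h /=; congr (_ *: (f _ - _)).
  have -> : h *: (1 : R) = h by exact: mulr1.
  by rewrite scalerDl addrCA.
by split; [rewrite /derivable E|rewrite /derive E].
Qed.

End slices.

(** * Integration by parts on the torus *)

Section torus_integral.
Context {R : realType}.
Local Notation mR := (measurableTypeR R).
Local Notation mu := (@lebesgue_measure R).
Implicit Types (f g : 'rV[R]_3 -> R).

Lemma vec3D (j : 'I_3) (q : mR * mR * mR) (s : R) :
  vec3 q + s *: delta_mx 0 j = vec3
    (q.1.1 + s * (0 == j :> nat)%:R, q.1.2 + s * (1 == j :> nat)%:R,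
     q.2 + s * (2 == j :> nat)%:R).
Proof.
by apply/rowP => -[[|[|[|//]]] i]; rewrite !mxE.
Qed.

Lemma continuous_slice f (p v : 'rV[R]_3) : continuous (f : _ -> R^o) ->
  continuous ((fun s : R => f (p + s *: v)) : R -> R^o).
Proof.
move=> cf s; apply: continuous_comp; last exact: cf.
apply: cvgD; first exact: cvg_cst.
by apply: cvgZr_tmp; exact: cvg_id.
Qed.

Lemma measurable_vec3 f : continuous (f : _ -> R^o) ->
  measurable_fun setT (f \o @vec3 R).
Proof.
move=> cf.
have c0 y z : continuous ((fun x => f (vec3 (x, y, z))) : R -> R^o).
  have -> : (fun x => f (vec3 (x, y, z))) =
      (fun s => f (vec3 (0, y, z) + s *: delta_mx 0 0)).
    by apply/funext => s; rewrite vec3D /= !mulr0 !addr0 mulr1 add0r.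
  exact: continuous_slice.
have c1 x z : continuous ((fun y => f (vec3 (x, y, z))) : R -> R^o).
  have -> : (fun y => f (vec3 (x, y, z))) =
      (fun s => f (vec3 (x, 0, z) + s *: delta_mx 0 1)).
    by apply/funext => s; rewrite vec3D /= !mulr0 !addr0 mulr1 add0r.
  exact: continuous_slice.
have c2 x y : continuous ((fun z => f (vec3 (x, y, z))) : R -> R^o).
  have -> : (fun z => f (vec3 (x, y, z))) =
      (fun s => f (vec3 (x, y, 0) + s *: delta_mx 0 2%:R)).
    by apply/funext => s; rewrite vec3D /= !mulr0 !addr0 mulr1 add0r.
  exact: continuous_slice.
apply: measurable_fun_caratheodory => [z|[x y]]; last exact: c2.
have -> : (fun t => (f \o @vec3 R) (t, z)) = (fun t => f (vec3 (t.1, t.2, z))).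
  by apply/funext => -[].
apply: measurable_fun_caratheodory => [y|x] /=; last exact: c1.
exact: continuous_measurable_fun (c0 y z).
Qed.

Lemma measurable_square :
  measurable (`[0, 1]%classic `*` `[0, 1]%classic : set (mR * mR)).
Proof. by apply: measurableX; exact: measurable_itv. Qed.

Lemma measurable_cube : measurable (@cube R).
Proof. by apply: measurableX; [exact: measurable_square|exact: measurable_itv]. Qed.

Lemma lebesgue_unit_itv : mu `[0, 1]%classic = 1%E.
Proof. by rewrite lebesgue_measure_itv /= lte_fin ltr01 -EFinD subr0. Qed.

Lemma leb2_square : @leb2 R (`[0, 1]%classic `*` `[0, 1]%classic) = 1%E.
Proof.
rewrite /leb2 product_measure1E; [|exact: measurable_itv|exact: measurable_itv].
by rewrite -[RHS]mule1; congr (_ * _)%E; exact: lebesgue_unit_itv.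
Qed.

Lemma leb3_cube : @leb3 R (@cube R) = 1%E.
Proof.
transitivity (leb2 (`[0%R, 1%R]%classic `*` `[0%R, 1%R]%classic : set (mR * mR)) *
    mu `[0%R, 1%R]%classic)%E.
  by apply: product_measure1E; [exact: measurable_square|exact: measurable_itv].
by rewrite leb2_square lebesgue_unit_itv mule1.
Qed.

Lemma cube_bounded f : continuous (f : _ -> R^o) ->
  exists K, forall q, cube q -> `|f (vec3 q)| <= K.
Proof.
move=> cf.
pose A := [set v : 'rV[R]_3 | forall i, `[0, 1]%classic (v ord0 i)].
have cA : compact A 
  by apply: (@rV_compact R 3 (fun=> `[0, 1]%classic)) => _; exact: segment_compact.
have : compact [set f x | x in A] by apply: continuous_compact => //;
  exact: continuous_subspaceT.
move=> /compact_bounded/ex_strict_bound_gt0[K K0 hK].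
exists K => -[[x y] z] [[/= xI yI] zI]; apply/ltW/hK; exists (vec3 (x, y, z)) => //.
by case=> -[|[|[|//]]] i; rewrite mxE.
Qed.

Lemma leb3_integrable f : continuous (f : _ -> R^o) ->
  leb3.-integrable (@cube R) (EFin \o (f \o @vec3 R)).
Proof.
move=> cf; apply: measurable_bounded_integrable; first exact: measurable_cube.
- by rewrite leb3_cube ltry.
- by apply: measurable_funTS; exact: measurable_vec3.
have [K hK] := cube_bounded cf.
exists K; split; first exact: num_real.
by move=> r Kr q cq; apply: le_trans (hK q cq) _; exact: ltW.
Qed.

Lemma integral_derive_periodic (f g : R -> R) :
  continuous (g : R -> R^o) -> (forall s : R, is_derive s 1 (f : R -> R^o) (g s)) ->
  f 0 = f 1 -> (\int[mu]_(s in `[0%R, 1%R]) (g s)%:E = 0)%E.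
Proof.
move=> cg dfg f01; have cf s : {for s, continuous (f : R -> R^o)}.
  by apply: differentiable_continuous; apply/derivable1_diffP; case: (dfg s).
rewrite (@continuous_FTC2 _ g f 0 1 ltr01) ?f01 ?subee//.
- exact: continuous_subspaceT.
- split; first by move=> s _; case: (dfg s).
    by apply: cvg_at_right_filter; exact: cf.
  by apply: cvg_at_left_filter; exact: cf.
- by move=> s _; rewrite derive1E; case: (dfg s).
Qed.

(** On every line in direction j the integral vanishes by the fundamental theorem of calculus and
    periodicity. The cube is a nested product, so direction 2 takes one application of Fubini;
    directions 0 and 1 take a second one, in the square at fixed z. *)
Lemma torus_int_pd (j : 'I_3) f : t3_periodic f -> class_C 1 f ->
  torus_int (pd j f) = 0.
Proof.
move=> pf /class_CS[cf df /(_ j)/class_C0 cd].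
have slice0 (p : 'rV[R]_3) :
    (\int[mu]_(s in `[0%R, 1%R]) (pd j f (p + s *: delta_mx 0 j))%:E = 0)%E.
  apply: (@integral_derive_periodic (fun s => f (p + s *: delta_mx 0 j))).
  - exact: continuous_slice.
  - by move=> s; apply: is_derive_slice; exact: df.
  - by rewrite scale0r addr0 scale1r pf.
suff h : (\int[leb3]_(q in @cube R) (pd j f (vec3 q))%:E = 0)%E.
  by rewrite /torus_int /Rintegral h.
have I3 := leb3_integrable cd; have m2 := measurable_square.
have mI : measurable (`[0%R, 1%R]%classic : set mR) by exact: measurable_itv.
have slice x y z k : j = k :> nat -> (\int[mu]_(s in `[0%R, 1%R])
    (pd j f (vec3 (if k == 0 then s else x, if k == 1 then s else y,
                   if k == 2 then s else z)))%:E = 0)%E.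
  (* The line is based on the face where coordinate k is 0, so that its parameter s is that
     coordinate. *)
  move=> jk; rewrite -[RHS](slice0 (vec3 (if k == 0 then 0 else x,
    if k == 1 then 0 else y, if k == 2 then 0 else z))).
  apply: eq_integral => s _; rewrite vec3D jk /=.
  case: k jk => [|[|[|k]]] jk; rewrite /= ?(mulr0, mulr1, add0r, addr0)//.
have [j2|j2] := eqVneq (j : nat) 2.
  apply: integral_slice1_0 => // -[x y] _; exact: (slice x y 0 2 j2).
apply: integral_slice2_0 => // z zI.
have i2 : leb2.-integrable (`[0%R, 1%R]%classic `*` `[0%R, 1%R]%classic)
    (EFin \o (fun p : mR * mR => pd j f (vec3 (p, z)))).
  apply: measurable_bounded_integrable; first exact: measurable_square.
  - by apply: le_lt_trans (ltry 1); rewrite -leb2_square.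
  - apply: measurable_funTS.
    exact: (measurableT_comp (measurable_vec3 cd) (pair2_measurable z)).
  have [K hK] := cube_bounded cd; exists K; split; first exact: num_real.
  by move=> r Kr p sp; apply: le_trans (hK (p, z) _) _; [split|exact: ltW].
have [j1|j1] := eqVneq (j : nat) 1%N.
  apply: (@integral_slice1_0 _ _ _ _ _ mu mu) => // x _.
  exact: (slice x 0 z 1%N j1).
have j0 : j = 0 :> nat by case: (j) j2 j1 => -[|[|[|]]].
apply: (@integral_slice2_0 _ _ _ _ _ mu mu) => // y _.
exact: (slice 0 y z 0 j0).
Qed.

Lemma torus_intD f g : continuous (f : _ -> R^o) -> continuous (g : _ -> R^o) ->
  torus_int (f \+ g) = torus_int f + torus_int g.
Proof.
move=> cf cg; exact: (RintegralD measurable_cube (leb3_integrable cf)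
  (leb3_integrable cg)).
Qed.

Lemma torus_intZ f (k : R) : continuous (f : _ -> R^o) ->
  torus_int (fun x => k * f x) = k * torus_int f.
Proof.
move=> cf; exact: (RintegralZl _ measurable_cube (leb3_integrable cf)).
Qed.

Lemma torus_int_cst (k : R) : torus_int (fun=> k) = k.
Proof.
rewrite /torus_int (_ : _ \o _ = cst k)// Rintegral_cst; last exact: measurable_cube.
by rewrite leb3_cube mulr1.
Qed.

Lemma torus_int_sum (I : Type) (r : seq I) (f : I -> 'rV[R]_3 -> R) :
  (forall i, continuous (f i : _ -> R^o)) ->
  torus_int (fun x => \sum_(i <- r) f i x) = \sum_(i <- r) torus_int (f i).
Proof.
move=> cf; elim: r => [|i r IH].
  by under eq_fun do rewrite big_nil; rewrite torus_int_cst big_nil.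
have -> : (fun x => \sum_(j <- i :: r) f j x) =
    f i \+ (fun x => \sum_(j <- r) f j x).
  by apply/funext => x; rewrite big_cons.
rewrite torus_intD ?big_cons ?IH//; apply/class_C0/class_C_sum => j.
exact/class_C0.
Qed.

Lemma torus_int_by_parts (j : 'I_3) f g : t3_periodic f -> t3_periodic g ->
  class_C 1 f -> class_C 1 g ->
  torus_int (pd j f \* g) = - torus_int (f \* pd j g).
Proof.
move=> pf pg cf cg; apply/eqP; rewrite -addr_eq0 -torus_intD; last 2 first.
- apply: class_C_continuous (class_CM (class_C_pd j cf) _).
  exact: class_C_le (leq0n 1) cg.
- apply: class_C_continuous (class_CM _ (class_C_pd j cg)).
  exact: class_C_le (leq0n 1) cf.
have /class_CS[_ df _] := cf; have /class_CS[_ dg _] := cg.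
rewrite -(pdM (df j) (dg j)); apply/eqP; apply: torus_int_pd.
  by move=> i x; rewrite /= pf pg.
exact: class_CM cf cg.
Qed.

Lemma pd_periodic (j : 'I_3) f : t3_periodic f -> t3_periodic (pd j f).
Proof. by move=> pf i; apply: pd_shift => x; exact: pf. Qed.

Lemma pds_periodic s f : t3_periodic f -> t3_periodic (pds s f).
Proof. by move=> pf; elim: s => //= j s; exact: pd_periodic. Qed.

(** The outermost derivative of f is moved first and ends up innermost on g, which reverses [s]. *)
Lemma torus_int_by_parts_pds s f g M : t3_periodic f -> t3_periodic g ->
  (size s <= M)%N -> class_C M f -> class_C M g ->
  torus_int (pds s f \* g) = (-1) ^+ size s * torus_int (f \* pds (rev s) g).
Proof.
move=> pf pg; elim: s g pg M => [|j s IH] g pg M sM cf cg.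
  by rewrite expr0 mul1r.
case: M sM cf cg => // M /= sM cf cg.
have cds : class_C 1 (pds s f).
  by apply: class_C_le (class_C_pds (leqW sM) cf); rewrite subn_gt0.
rewrite (torus_int_by_parts j (pds_periodic s pf) pg cds (class_C_le _ cg))//.
rewrite (IH _ (pd_periodic j pg) _ sM (class_C_le (leqnSn M) cf) (class_C_pd j cg)).
by rewrite rev_cons pds_rcons exprS mulN1r mulNr.
Qed.

End torus_integral.

(** * The one-dimensional kernels and their periodic primitives *)

Section trigonometric_polynomials.
Context {R : realType}.
Implicit Types (f g : R -> R) (x y : R).

(** A class that contains the kernels and their primitives and is closed under differentiation: all
    higher derivatives exist without being computed. *)
Inductive trig : (R -> R) -> Prop :=
| trig_cst c : trig (cst c)
| trig_cos : trig (fun x => cos (pi * x))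
| trig_sin : trig (fun x => sin (pi * x))
| trig_add f g : trig f -> trig g -> trig (f \+ g)
| trig_mul f g : trig f -> trig g -> trig (f \* g).

Lemma trigX f n : trig f -> trig (fun x => f x ^+ n).
Proof.
move=> tf; elim: n => [|n IH]; first exact: (trig_cst 1).
have -> : (fun x => f x ^+ n.+1) = f \* (fun x => f x ^+ n).
  by apply/funext => x; rewrite exprS.
exact: trig_mul.
Qed.

Lemma is_derive_cospi x : is_derive x 1 (fun x => cos (pi * x)) (- pi * sin (pi * x)).
Proof.
have h : is_derive x 1 (fun x : R => pi * x) pi.
  by apply: is_derive_eq; rewrite [RHS](esym (mulr1 _)).
by apply: is_derive_eq (is_derive1_comp (is_derive_cos _) h) _; rewrite mulNr mulrC mulNr.
Qed.

Lemma is_derive_sinpi x : is_derive x 1 (fun x => sin (pi * x)) (pi * cos (pi * x)).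
Proof.
have h : is_derive x 1 (fun x : R => pi * x) pi.
  by apply: is_derive_eq; rewrite [RHS](esym (mulr1 _)).
by apply: is_derive_eq (is_derive1_comp (is_derive_sin _) h) _; rewrite mulrC.
Qed.

Lemma trig_derive f : trig f ->
  exists2 g, trig g & forall x, is_derive x 1 (f : R -> R^o) (g x).
Proof.
elim=> [c||| {}f g tf [f' tf' df] tg [g' tg' dg]| {}f g tf [f' tf' df] tg [g' tg' dg]].
- by exists (cst 0); [exact: trig_cst|move=> x; exact: is_derive_cst].
- exists (fun x => - pi * sin (pi * x)); last exact: is_derive_cospi.
  exact: trig_mul (trig_cst _) trig_sin.
- exists (fun x => pi * cos (pi * x)); last exact: is_derive_sinpi.
  exact: trig_mul (trig_cst _) trig_cos.
- by exists (f' \+ g'); [exact: trig_add|move=> x; exact: is_deriveD].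
- exists ((f \* g') \+ (g \* f')); first by apply: trig_add; exact: trig_mul.
  by move=> x; exact: (is_deriveM (df x) (dg x)).
Qed.

Lemma trig_derive1n f k : trig f ->
  trig (derive1n k f) /\
  forall x, is_derive x 1 (derive1n k f : R -> R^o) (derive1n k.+1 f x).
Proof.
move=> tf; have tk : trig (derive1n k f).
  elim: k => // k tk; have [g tg dg] := trig_derive tk.
  rewrite derive1nS (_ : _^`()%classic = g)//.
  by apply/funext => x; rewrite derive1E; have [_] := dg x.
split=> [|x]; first exact: tk.
have [g _ dg] := trig_derive tk.
apply: is_derive_eq (dg x) _.
by rewrite derive1nS derive1E; have [_] := dg x.
Qed.

Lemma periodic_int f : (forall x, f (x + 1) = f x) ->
  forall x (m : int), f (x + m%:~R) = f x.
Proof.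
move=> pf; have pn n x : f (x + n%:R) = f x.
  by elim: n x => [|n IH] x; rewrite ?addr0// -natr1 addrA pf IH.
move=> x [] n; first exact: pn.
rewrite NegzE mulrNz -(pn n.+1 (x - _)); congr f; exact: subrK.
Qed.

(* The mean value of cos (pi x) ^+ (2 n). *)
Fixpoint cos_mean n : R :=
  if n is m.+1 then cos_mean m * ((m.*2.+1)%:R / (m.*2.+2)%:R) else 1.

(* A periodic primitive of cos (pi x) ^+ (2 n) minus its mean, given by the
   reduction formula. *)
Fixpoint cos_prim n x : R :=
  if n is m.+1 then
    (m.*2.+1)%:R / (m.*2.+2)%:R * cos_prim m x
    + (pi * (m.*2.+2)%:R)^-1 * (cos (pi * x) ^+ m.*2.+1 * sin (pi * x))
  else 0.

(** The mean is binomial(2n, n) / 4^n, of order n^{-1/2}. The crude bound is enough, because it only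
    has to lose against an exponential in n. *)
Lemma cos_mean_ge n : (0 < n)%N -> (n.*2)%:R^-1 <= cos_mean n.
Proof.
case: n => // n _; elim: n => [|n IH]; first by rewrite /= !mul1r.
have -> : cos_mean n.+2 = cos_mean n.+1 * ((n.+1.*2.+1)%:R / (n.+1.*2.+2)%:R) by [].
apply: le_trans (_ : (n.+1.*2)%:R^-1 * ((n.+1.*2.+1)%:R / (n.+1.*2.+2)%:R) <= _).
  rewrite mulrA [n.+2.*2]doubleS ler_peMl// ?invr_ge0 ?ler0n//.
  by rewrite mulrC ler_pdivlMr ?ltr0n// mul1r ler_nat.
by rewrite ler_wpM2r// divr_ge0.
Qed.

Lemma cos_mean_gt0 n : 0 < cos_mean n.
Proof. by elim: n => //= n IH; rewrite mulr_gt0// divr_gt0 ?ltr0n. Qed.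

Lemma trig_cos_prim n : trig (cos_prim n).
Proof.
elim: n => [|n IH]; first exact: (trig_cst 0).
apply: trig_add; apply: trig_mul; try exact: trig_cst; first exact: IH.
by apply: trig_mul trig_sin; exact: trigX trig_cos.
Qed.

Lemma is_derive_cos_prim n x :
  is_derive x 1 (cos_prim n) (cos (pi * x) ^+ n.*2 - cos_mean n).
Proof.
elim: n => [|n IH] /=.
  by rewrite expr0 subrr; exact: is_derive_cst.
have dX := is_deriveX n.*2.+1 (is_derive_cospi x).
have E : (fun x : R => cos (pi * x)) ^+ n.*2.+1 =
    (fun x => cos (pi * x) ^+ n.*2.+1) by apply/funext => y; rewrite exprfctE.
rewrite E in dX.
have dM := is_deriveM dX (is_derive_sinpi x).
have dZ := is_deriveZ (pi * (n.*2.+2)%:R)^-1 dM.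
have dP := is_deriveZ ((n.*2.+1)%:R / (n.*2.+2)%:R) IH.
apply: is_derive_eq (is_deriveD dP dZ) _.
rewrite /GRing.scale /=.
have p0 : pi != 0 :> R by rewrite gt_eqF ?pi_gt0.
have n0 : (n.*2.+2)%:R != 0 :> R by rewrite pnatr_eq0.
have N1 : (n.*2.+1)%:R = (n.*2.+2)%:R - 1 :> R by rewrite -[in RHS]natr1 addrK.
rewrite doubleS !exprS N1 /=.
move: (_ %:R) (cos _ ^+ _) (cos_mean n) n0 => N T A n0.
set C := cos _; set S := sin _.
(* Once sin^2 is replaced by 1 - cos^2, a rational identity in independent variables remains. *)
have -> : S * ((N - 1) * T * (- pi * S)) = - pi * (N - 1) * T * (1 - C ^+ 2).
  by rewrite -sin2cos2 -/S; ring.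
clearbody C S; move: pi p0 => p p0.
by field; rewrite n0 p0.
Qed.

Lemma cos_prim_periodic n x : cos_prim n (x + 1) = cos_prim n x.
Proof.
elim: n => //= n ->; congr (_ + _ * _).
rewrite mulrDr mulr1 cosDpi sinDpi exprNn -signr_odd /= odd_double /=.
by rewrite expr1 mulN1r mulrNN.
Qed.

Lemma cos_prim_int n (m : int) : cos_prim n m%:~R = 0.
Proof.
rewrite -[m%:~R]add0r (periodic_int (cos_prim_periodic n)).
by elim: n => //= n ->; rewrite !mulr0 sin0 !mulr0 addr0.
Qed.

Definition cos_kernel n x : R := cos (pi * x) ^+ n.*2 / cos_mean n.
Definition cos_kernel_prim n x : R := cos_prim n x / cos_mean n.

Lemma trig_cos_kernel n : trig (cos_kernel n).
Proof. exact: trig_mul (trigX _ trig_cos) (trig_cst _). Qed.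

Lemma trig_cos_kernel_prim n : trig (cos_kernel_prim n).
Proof. exact: trig_mul (trig_cos_prim n) (trig_cst _). Qed.

Lemma cos_kernel_ge0 n x : 0 <= cos_kernel n x.
Proof.
by rewrite divr_ge0 ?(ltW (cos_mean_gt0 n))// -mul2n exprM exprn_ge0 ?sqr_ge0.
Qed.

Lemma cos_kernel_le n x : (0 < n)%N ->
  cos_kernel n x <= n.*2%:R * (cos (pi * x) ^+ 2) ^+ n.
Proof.
move=> n0; rewrite /cos_kernel -mul2n exprM mulrC.
rewrite ler_wpM2r//; first by rewrite exprn_ge0 ?sqr_ge0.
rewrite mul2n -[leRHS]invrK.
rewrite lef_pV2 ?posrE ?cos_mean_gt0 ?invr_gt0 ?ltr0n ?double_gt0//.
exact: cos_mean_ge.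
Qed.

Lemma cos_kernel_periodic n x : cos_kernel n (x + 1) = cos_kernel n x.
Proof.
by rewrite /cos_kernel mulrDr mulr1 cosDpi -mul2n !exprM sqrrN.
Qed.

Lemma is_derive_cos_kernel_prim n x :
  is_derive x 1 (cos_kernel_prim n) (cos_kernel n x - 1).
Proof.
have -> : cos_kernel_prim n = (cos_mean n)^-1 \*: cos_prim n.
  by apply/funext => y; rewrite /cos_kernel_prim mulrC.
apply: is_derive_eq; first exact/is_deriveZ/is_derive_cos_prim.
rewrite /GRing.scale /= mulrC mulrBl divff// gt_eqF//; exact: cos_mean_gt0.
Qed.

Lemma cos_kernel_prim_periodic n x :
  cos_kernel_prim n (x + 1) = cos_kernel_prim n x.
Proof. by rewrite /cos_kernel_prim cos_prim_periodic. Qed.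

(* The primitive W vanishes at the integers, and W + id is nondecreasing. *)
Lemma cos_kernel_prim_le1 n x : `|cos_kernel_prim n x| <= 1.
Proof.
have homo : {homo (fun x => cos_kernel_prim n x + x) : a b / a <= b}.
  move=> a b; rewrite le_eqVlt => /predU1P[->//|ab].
  have d y : is_derive y 1 ((cos_kernel_prim n : R -> R^o) \+ id) (cos_kernel n y).
    apply: is_derive_eq (is_deriveD (is_derive_cos_kernel_prim n y)
      (is_derive_id y 1)) _.
    by rewrite subrK.
  have [|z _ h] := @MVT R _ (cos_kernel n) a b ab (fun y _ => d y).
    apply: derivable_within_continuous => y _; exact: (@ex_derive _ _ _ _ _ _ _ (d y)).
  by rewrite -subr_ge0 h mulr_ge0 ?cos_kernel_ge0// subr_ge0 ltW.
have z (m : int) : cos_kernel_prim n m%:~R = 0.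
  by rewrite /cos_kernel_prim cos_prim_int mul0r.
(* With m the floor of x, monotonicity of W + id gives m <= W x + x <= m + 1, while m <= x < m +
   1. *)
have /andP[xl xr] := floor_itv x.
have := homo _ _ xl; have := homo _ _ (ltW xr); rewrite !z !add0r => h1 h2.
by rewrite ler_norml; move: xl xr h1 h2; rewrite intrD; lra.
Qed.

End trigonometric_polynomials.

(** * Products of one-dimensional functions *)

Section tensor_products.
Context {R : realType}.
Implicit Types (F : 'I_3 -> R -> R) (x y : 'rV[R]_3).

Definition tensor y F x : R := \prod_j F j (x 0 j - y 0 j).

Lemma tensor_continuous y F : (forall j, continuous (F j : R -> R^o)) ->
  continuous (tensor y F : _ -> R^o).
Proof.
move=> cF; have -> : tensor y F =
    (\big[GRing.mul/1]_j (fun x => F j (x 0 j - y 0 j)) : 'rV[R]_3 -> R).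
  by apply/funext => x; rewrite fct_prodE.
elim/big_ind : _ => [|f g cf cg x|j _ x]; first exact: cst_continuous.
  exact: (@cvgM _ _ _ _ _ _ _ _ (cf x) (cg x)).
apply: continuous_comp; last exact: cF.
exact: (@cvgB _ R^o _ _ _ _ _ _ _ (@coord_continuous R 1 3 0 j x) (cvg_cst _)).
Qed.

(** Along [delta_mx 0 i] only factor i varies, so the difference quotient is a one-dimensional one
    times the constant [C]. *)
Lemma is_derive_tensor y F i (G : R -> R) x :
  (forall t : R, is_derive t 1 (F i : R -> R^o) (G t)) ->
  is_derive x (delta_mx 0 i) (tensor y F : _ -> R^o)
    (tensor y (fun j => if j == i then G else F j) x).
Proof.
move=> dF; set a := x 0 i - y 0 i.
pose C := \prod_(j | j != i) F j (x 0 j - y 0 j).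
have -> : tensor y (fun j => if j == i then G else F j) x = G a * C.
  rewrite /tensor (bigD1 i)//= eqxx; congr (_ * _).
  by apply: eq_bigr => j /negbTE ->.
have Ex : tensor y F x = F i a * C by rewrite /tensor (bigD1 i).
have Ez (h : R) : tensor y F (h *: delta_mx 0 i + x) = F i (h + a) * C.
  rewrite /tensor (bigD1 i)//=; congr (F i _ * _).
    by rewrite !mxE !eqxx /= mulr1 addrA.
  by apply: eq_bigr => j /negbTE ji; rewrite !mxE ji /= mulr0 add0r.
have cv : h^-1 *: ((tensor y F \o shift x) (h *: delta_mx 0 i) - tensor y F x : R^o)
    @[h --> 0^'] --> G a * C.
  have -> : (fun h : R => h^-1 *:
       ((tensor y F \o shift x) (h *: delta_mx 0 i) - tensor y F x : R^o)) =
      (fun h => (h^-1 *: ((F i \o shift a) (h *: (1 : R^o)) - F i a : R^o)) * C).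
    apply/funext => h /=; rewrite Ex Ez -mulrBl.
    have -> : h *: (1 : R^o) + a = h + a by congr (_ + _); exact: mulr1.
    exact: mulrA.
  have [df <-] := dF a; exact: (@cvgM _ _ _ _ _ _ _ _ df (cvg_cst C)).
split; first by apply/cvg_ex; exists (G a * C).
exact/cvg_lim.
Qed.

Lemma trig_continuous (f : R -> R) : trig f -> continuous (f : R -> R^o).
Proof.
move=> /trig_derive[g _ dg] t; apply: differentiable_continuous.
by apply/derivable1_diffP; case: (dg t).
Qed.

(** The right-hand side depends on [s] only through its counts: for tensor products the symmetry of
    mixed derivatives is visible. *)
Lemma pds_tensor y F s : (forall j, trig (F j)) ->
  pds s (tensor y F) = tensor y (fun j => derive1n (count_mem j s) (F j)).
Proof.
move=> tF; elim: s => [|i s IH]; first by [].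
rewrite [LHS]/= IH; apply/funext => x; rewrite /pd.
have [_ dF] := trig_derive1n (count_mem i s) (tF i).
have [_ ->] := @is_derive_tensor y
  (fun j => derive1n (count_mem j s) (F j)) i _ x dF.
by apply: eq_bigr => j _ /=; case: eqVneq => [->|].
Qed.

Lemma class_C_tensor M y F : (forall j, trig (F j)) -> class_C M (tensor y F).
Proof.
move=> tF s; rewrite pds_tensor//; split=> _.
  apply: tensor_continuous => j; apply: trig_continuous.
  by have [] := trig_derive1n (count_mem j s) (tF j).
move=> i p; have [_ dF] := trig_derive1n (count_mem i s) (tF i).
by have [] := @is_derive_tensor y (fun j => derive1n (count_mem j s) (F j)) i _ p dF.
Qed.

Lemma tensor_periodic y F : (forall j t, F j (t + 1) = F j t) ->
  t3_periodic (tensor y F).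
Proof.
move=> pF i x; apply: eq_bigr => j _; rewrite !mxE eqxx /=.
by case: eqP => _; rewrite ?addr0// addrAC pF.
Qed.

End tensor_products.

(** * The three-dimensional kernel as an approximate identity *)

Section approximate_identity.
Context {R : realType}.
Implicit Types (u : 'rV[R]_3 -> R) (x y : 'rV[R]_3).

Definition kernel3 n y := tensor y (fun=> @cos_kernel R n).

(* kernel3 n is the product over j of 1 + W'(x_j - y_j); this is W(x_j - y_j)
   over the j in A. *)
Definition kernel3_prim n (A : {set 'I_3}) y :=
  tensor y (fun j => if j \in A then @cos_kernel_prim R n else cst 1).

Lemma trig_kernel3_prim n (A : {set 'I_3}) j :
  trig (if j \in A then @cos_kernel_prim R n else cst 1).
Proof. by case: ifP => _; [exact: trig_cos_kernel_prim|exact: trig_cst]. Qed.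

Lemma kernel3_prim_periodic n A y : t3_periodic (kernel3_prim n A y).
Proof.
apply: tensor_periodic => j t; case: ifP => // _.
exact: cos_kernel_prim_periodic.
Qed.

Lemma class_C_kernel3_prim M n A y : class_C M (kernel3_prim n A y).
Proof. by apply: class_C_tensor => j; exact: trig_kernel3_prim. Qed.

Lemma kernel3_prim_le1 n A y x : `|kernel3_prim n A y x| <= 1.
Proof.
rewrite /kernel3_prim /tensor normr_prod.
apply: prodr_ile1 => j _; rewrite normr_ge0 /=.
by case: ifP => _; rewrite ?normr1// cos_kernel_prim_le1.
Qed.

Lemma kernel3_sum n y :
  kernel3 n y = (fun x => \sum_(A : {set 'I_3}) pds (enum A) (kernel3_prim n A y) x).
Proof.
apply/funext => x; rewrite /kernel3 /tensor.
under eq_bigr => j _ do rewrite -(subrK 1 (cos_kernel n _)).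
rewrite bigA_distr; apply: eq_bigr => A _.
rewrite pds_tensor; last by move=> j; exact: trig_kernel3_prim.
(* Each direction occurs at most once in [enum A]: factor j is differentiated once if j is in A and
   is the constant 1 otherwise. *)
apply: eq_bigr => j _; rewrite count_uniq_mem ?enum_uniq// mem_enum.
case: ifP => // _; rewrite derive1n1 derive1E.
by have [_ ->] := is_derive_cos_kernel_prim n (x 0 j - y 0 j).
Qed.

(** In the expansion over subsets only the empty set contributes; every other term is a derivative
    of a periodic function. *)
Lemma torus_int_kernel3 n y : torus_int (kernel3 n y) = 1.
Proof.
rewrite kernel3_sum torus_int_sum; last first.
  move=> A; apply: (@class_C_continuous _ _ 0).
  have := class_C_pds (leqnn _) (class_C_kernel3_prim (size (enum A)) n A y).
  by rewrite subnn.
rewrite (bigD1 (finset.set0 : {set 'I_3}))//= finset.enum_set0 big1 ?addr0.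
  rewrite -[RHS]torus_int_cst /kernel3_prim /tensor; congr torus_int.
  by apply/funext => x /=; rewrite big1// => j _; rewrite inE.
move=> A /finset.set0Pn[i iA]; case E : (enum A) => [|j s].
  by move: iA; rewrite -mem_enum E.
apply: torus_int_pd; first exact: pds_periodic (kernel3_prim_periodic n A y).
have := class_C_pds (leqnSn (size s)) (class_C_kernel3_prim (size s).+1 n A y).
by rewrite subSnn.
Qed.

Lemma class_C_kernel3 M n y : class_C M (kernel3 n y).
Proof. by apply: class_C_tensor => j; exact: trig_cos_kernel. Qed.

Lemma kernel3_ge0 n y x : 0 <= kernel3 n y x.
Proof. by apply: prodr_ge0 => j _; exact: cos_kernel_ge0. Qed.

Lemma t3_periodic_int u x (m : 'I_3 -> int) : t3_periodic u ->
  u (x + \row_j (m j)%:~R) = u x.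
Proof.
move=> pu; rewrite [\row_j _]row_sum_delta.
elim/big_rec : _ => [|j v _ <-]; first by rewrite addr0.
rewrite mxE addrCA addrC -[x + v in RHS]addr0 -[in RHS](scale0r (delta_mx 0 j)).
rewrite -[m j in LHS]/(m j) -[(m j)%:~R]add0r.
apply: (@periodic_int _ (fun t => u (x + v + t *: delta_mx 0 j))) => t.
by rewrite scalerDl scale1r addrA pu.
Qed.

(** Write q^n = exp(- n c) with c = - ln q and use exp(s) >= s^4 / 4!. Then (2n)^3 q^n <= 8 * 24 /
    (n c^4), which explains 192. The case q = 0 is separate because it has no logarithm. *)
Lemma exp_decay_cube (q e : R) : 0 <= q < 1 -> 0 < e ->
  exists2 n, (0 < n)%N & n.*2%:R ^+ 3 * q ^+ n <= e.
Proof.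
move=> /andP[]; rewrite le_eqVlt => /predU1P[<- _ e0|q0 q1 e0].
  by exists 1%N; rewrite // expr1 mulr0 ltW.
pose c := - ln q; have c0 : 0 < c by rewrite oppr_gt0 ln_lt0// q0.
have b0 : 0 <= 192 / (c ^+ 4 * e) 
  by rewrite divr_ge0 ?ler0n// ltW// mulr_gt0// exprn_gt0.
pose n := (Num.bound (192 / (c ^+ 4 * e))).+1.
have nb : 192 / (c ^+ 4 * e) <= n%:R.
  by rewrite ltW// (lt_le_trans (archi_boundP b0))// ler_nat.
have n0 : 0 < n%:R :> R by rewrite ltr0n.
exists n => //.
have -> : q ^+ n = (expR (n%:R * c))^-1.
  by rewrite /c expRM_natl expRN lnK ?posrE// exprVn invrK.
rewrite ler_pdivrMr ?expR_gt0//.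
have h : (n%:R * c) ^+ 4 / 4`!%:R <= expR (n%:R * c).
  apply: le_trans (expR_ge1Dxn 3 _); first by rewrite lerDr.
  by rewrite mulr_ge0 ?ltW.
apply: le_trans (ler_wpM2l (ltW e0) h).
rewrite -muln2 natrM; move: nb; rewrite ler_pdivrMr ?mulr_gt0 ?exprn_gt0// => nb.
have -> : e * ((n%:R * c) ^+ 4 / 4`!%:R) = n%:R ^+ 3 * (n%:R * (c ^+ 4 * e)) / 24.
  by rewrite (_ : 4`! = 24)//; field.
rewrite ler_pdivlMr//.
have -> : (n%:R * 2) ^+ 3 * 24 = n%:R ^+ 3 * 192 :> R by ring.
by rewrite ler_wpM2l// exprn_ge0// ltW.
Qed.

Lemma torus_int_le f g : continuous (f : 'rV[R]_3 -> R^o) ->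
  continuous (g : 'rV[R]_3 -> R^o) ->
  (forall q, cube q -> `|f (vec3 q)| <= g (vec3 q)) ->
  `|torus_int f| <= torus_int g.
Proof.
move=> cf cg fg; apply: le_trans (le_normr_Rintegral measurable_cube
  (leb3_integrable cf)) _.
apply: le_Rintegral => //; [exact: measurable_cube| |exact: leb3_integrable].
have cnf : continuous ((fun x => `|f x|) : 'rV[R]_3 -> R^o).
  by move=> x; apply: continuous_comp; [exact: cf|exact: norm_continuous].
exact: (leb3_integrable cnf).
Qed.

(* Off a neighbourhood of y + Z^3 one of the factors is exponentially small,
   while the others are at most 2n. *)
Lemma kernel3_far n y x (d : R) (m : 'I_3 -> int) i : (0 < n)%N ->
  0 < d -> d <= `|x 0 i - y 0 i - (m i)%:~R| <= 2^-1 ->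
  kernel3 n y x <= n.*2%:R ^+ 3 * (cos (pi * d) ^+ 2) ^+ n.
Proof.
move=> n0 d0 /andP[dr r2].
have pi0 : 0 < pi :> R := pi_gt0 R.
(* By evenness the argument may be taken in [pi d, pi / 2], where [cos] is decreasing and
   nonnegative, so squares compare as well. *)
have cosr : cos (pi * (x 0 i - y 0 i - (m i)%:~R)) ^+ 2 <= cos (pi * d) ^+ 2.
  rewrite -[in leLHS]cos_norm normrM (ger0_norm (ltW pi0)).
  have I (t : R) : 0 < t -> t <= 2^-1 -> pi * t \in `[0, pi].
    move=> t0 t2; rewrite in_itv /= mulr_ge0 ?(ltW pi0) ?(ltW t0)//=.
    by rewrite ger_pMr// (le_trans t2)// invf_le1// ler1n.
  have P t : 0 < t -> t <= 2^-1 -> 0 <= cos (pi * t) :> R.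
    move=> t0 t2; apply: cos_ge0_pihalf; rewrite ler_pM2l//.
    by rewrite t2 andbT lerNl (le_trans (_ : _ <= 0))// ?oppr_le0 ?mulr_ge0 ?ltW.
  have r0 := lt_le_trans d0 dr; have d2 := le_trans dr r2.
  by rewrite lerXn2r ?nnegrE ?P// leNgt ltr_cos ?I// -leNgt ler_pM2l.
have -> : n.*2%:R ^+ 3 * (cos (pi * d) ^+ 2) ^+ n =
    \prod_(j < 3) (n.*2%:R * (if j == i then (cos (pi * d) ^+ 2) ^+ n else 1)).
  rewrite big_split /= prodr_const card_ord; congr (_ * _).
  by rewrite -big_mkcond /= big_pred1_eq.
apply: ler_prod => j _; rewrite cos_kernel_ge0 /=.
case: eqP => [->|_].
  have := periodic_int (@cos_kernel_periodic R n) (x 0 i - y 0 i) (- m i).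
  rewrite mulrNz => <-; apply: le_trans (cos_kernel_le _ n0) _.
  by rewrite ler_wpM2l// lerXn2r ?nnegrE ?sqr_ge0.
apply: le_trans (cos_kernel_le _ n0) _; rewrite ler_wpM2l//.
by rewrite exprn_ile1 ?sqr_ge0// -real_normK ?num_real// expr_le1// cos_max.
Qed.

(** As the kernel has mass 1, u(y) differs from the integral of u against it by that of u - u(y).
    Near y + Z^3 this difference is small by continuity and periodicity; elsewhere the kernel is
    small for a suitable n. *)
Lemma torus_int_kernel3_bound u y E : continuous (u : _ -> R^o) ->
  t3_periodic u ->
  (forall n, `|torus_int (u \* kernel3 n y)| <= E) -> `|u y| <= E.
Proof.
move=> cu pu hE; apply/ler_addgt0Pr => e e0.
have [K hK] := cube_bounded cu.
have e20 : 0 < e / 2 by rewrite divr_gt0.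
have [d0 d00 hd0] : exists2 d, 0 < d & forall r : 'rV[R]_3,
    (forall j, `|r 0 j| < d) -> `|u (y + r) - u y| < e / 2.
  move: (cu y) => /cvgrPdist_lt/(_ _ e20)/nbhs_ballP[d d0 hd].
  exists d => // r rd; rewrite distrC; apply: hd; split=> // i j.
  by rewrite mxE (ord1 i) /ball /= opprD addrA subrr add0r normrN.
pose d := Num.min d0 2^-1.
have d_gt0 : 0 < d by rewrite lt_min d00 invr_gt0 ltr0n.
have q01 : 0 <= cos (pi * d) ^+ 2 < 1.
  rewrite sqr_ge0 cos2sin2 ltrBlDr ltrDl exprn_gt0// sin_gt0_pi//.
  rewrite mulr_gt0 ?pi_gt0// gtr_pMr ?pi_gt0//.
  by rewrite (@le_lt_trans _ _ 2^-1) ?ge_min ?lexx ?orbT// invf_lt1// ltr1n.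
(* A bound for |u x - u y| on the cube; the added 1 makes it safe to divide by. *)
pose K' := `|K| + `|u y| + 1.
have K'0 : 0 < K' by rewrite /K' ltr_wpDl// addr_ge0.
have [n n0 hn] := exp_decay_cube q01 (divr_gt0 e20 K'0).
have ck : continuous (kernel3 n y : _ -> R^o).
  exact: class_C_continuous (class_C_kernel3 0 n y).
have cuk : continuous ((u \* kernel3 n y) : _ -> R^o).
  by apply/class_C0; apply: class_CM; apply/class_C0.
have cyk : continuous ((fun x => - u y * kernel3 n y x) : _ -> R^o).
  by apply/class_C0; apply: class_CZ; apply/class_C0.
have key : `|torus_int ((u \* kernel3 n y) \+ (fun x => - u y * kernel3 n y x))|
    <= e / 2 + e / 2.
  apply: (@le_trans _ _ (torus_int (fun x => e / 2 * kernel3 n y x + e / 2))).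
    apply: torus_int_le.
    - by apply/class_C0/class_CD; apply/class_C0.
    - apply/class_C0/class_CD; last exact: class_C_cst.
      by apply: class_CZ; apply/class_C0.
    move=> q cq; set x := vec3 q.
    rewrite /= -mulrDl normrM (ger0_norm (kernel3_ge0 _ _ _)).
    (* Rounding to the nearest integer puts the remainder r in [-1/2, 1/2]^3, the range in which
       [kernel3_far] applies. *)
    pose m j := Num.floor (x 0 j - y 0 j + 2^-1).
    pose r := \row_j (x 0 j - y 0 j - (m j)%:~R).
    have xE : x = (y + r) + \row_j (m j)%:~R.
      by apply/rowP => j; rewrite !mxE; ring.
    have [rd|] := pselect (forall j, `|r 0 j| < d).
      rewrite -[leLHS]addr0 lerD ?(ltW e20)// ler_wpM2r ?kernel3_ge0//.
      rewrite xE t3_periodic_int// ltW// hd0// => j.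
      by apply: lt_le_trans (rd j) _; rewrite ge_min lexx.
    move=> /existsNP[i /negP]; rewrite -leNgt mxE => di.
    have ri : `|x 0 i - y 0 i - (m i)%:~R| <= 2^-1.
      have := floor_itv (x 0 i - y 0 i + 2^-1); rewrite -/(m i) intrD.
      by rewrite ler_norml => /andP[]; lra.
    apply: (@le_trans _ _ (K' * (e / 2 / K'))).
      rewrite ler_pM ?kernel3_ge0//; last first.
        apply: le_trans hn; apply: (@kernel3_far n y x d m i) => //.
        by rewrite di ri.
      rewrite (le_trans (ler_normB _ _))// -[leLHS]addr0 lerD// lerD//.
      exact: le_trans (hK q cq) (ler_norm _).
    rewrite mulrC divfK ?gt_eqF// lerDr mulr_ge0 ?(ltW e20)//.
    exact: kernel3_ge0.
  rewrite torus_intD; last 2 first.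
  - by apply/class_C0/class_CZ; apply/class_C0.
  - exact: cst_continuous.
  by rewrite torus_intZ// torus_int_kernel3 torus_int_cst mulr1.
move: key; rewrite torus_intD// torus_intZ// torus_int_kernel3 mulr1 => key.
have -> : u y = torus_int (u \* kernel3 n y) - (torus_int (u \* kernel3 n y) - u y).
  by rewrite subKr.
rewrite (le_trans (ler_normB _ _))// lerD//.
by rewrite [e]splitr.
Qed.

End approximate_identity.

(** * Symmetry of mixed derivatives, and passage from sequences to multi-indices *)

Section symmetry_of_partial_derivatives.
Context {R : realType}.
Implicit Types (f : 'rV[R]_3 -> R) (s t : seq 'I_3).

Lemma pds_kernel3_perm s t n (y : 'rV[R]_3) : perm_eq s t ->
  pds s (kernel3 n y) = pds t (kernel3 n y).
Proof.
move=> /permP st; rewrite !pds_tensor; [|by move=> j; exact: trig_cos_kernel..].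
by congr tensor; apply/funext => j; rewrite st.
Qed.

(* Both mixed derivatives have the same integral against every kernel. *)
Lemma pd_comm i j f : t3_periodic f -> class_C 2 f ->
  pd i (pd j f) = pd j (pd i f).
Proof.
move=> pf cf.
have c2 k l : continuous (pd k (pd l f) : _ -> R^o).
  exact/class_C0/class_C_pd/class_C_pd.
have cuk k l n y : continuous ((pd k (pd l f) \* kernel3 n y) : _ -> R^o).
  apply/class_C0; apply: class_CM; first exact/class_C0.
  exact: class_C_kernel3.
pose u := pd i (pd j f) \+ (fun x => -1 * pd j (pd i f) x).
have cu : continuous (u : _ -> R^o).
  by apply/class_C0; apply: class_CD; [|apply: class_CZ]; apply/class_C0.
have pu : t3_periodic u.
  move=> k x; have := pds_periodic [:: i; j] pf k x.
  by rewrite /u /= => ->; have := pds_periodic [:: j; i] pf k x; rewrite /= => ->.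
suff u0 y : u y = 0.
  by apply/funext => y; apply/eqP; rewrite -subr_eq0 -[X in _ - X]mul1r -mulNr;
    apply/eqP; exact: u0.
apply/eqP; rewrite -normr_le0; apply: torus_int_kernel3_bound => // n.
have -> : u \* kernel3 n y = (pd i (pd j f) \* kernel3 n y) \+
    (fun x => -1 * (pd j (pd i f) \* kernel3 n y) x).
  by apply/funext => x; rewrite /u /= mulrDl mulrA.
have pk : t3_periodic (kernel3 n y).
  by apply: tensor_periodic => k; exact: cos_kernel_periodic.
have ck := class_C_kernel3 2 n y.
rewrite torus_intD//; last first.
  by apply/class_C0; apply: class_CZ; apply/class_C0; exact: cuk.
rewrite torus_intZ//.
have parts k l : torus_int (pd k (pd l f) \* kernel3 n y) =
    torus_int (f \* pds [:: l; k] (kernel3 n y)).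
  have := @torus_int_by_parts_pds _ [:: k; l] f _ 2 pf pk isT cf ck.
  by rewrite /= sqrrN expr1n mul1r.
have ij : perm_eq [:: j; i] [:: i; j] by apply/permP => a /=; rewrite !addn0 addnC.
rewrite [X in X + _](parts i j) [X in _ * X](parts j i) (pds_kernel3_perm n y ij).
by rewrite mulN1r subrr normr0.
Qed.

Lemma pd_pds_comm M i s f : t3_periodic f -> class_C M f -> (size s < M)%N ->
  pd i (pds s f) = pds s (pd i f).
Proof.
move=> pf cf; elim: s => [|j s IH sM]; first by [].
rewrite [RHS]/= -(IH (ltnW sM)); apply: pd_comm; first exact: pds_periodic.
by apply: class_C_le (class_C_pds (ltnW (ltnW sM)) cf); move: sM => /=; lia.
Qed.

(** The head of [s] is located in t = t1 ++ i :: t2 and commuted past t1, acting on the function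
    [pds t2 f] of class C^{M - |t2|}. *)
Lemma pds_perm M s t f : t3_periodic f -> class_C M f -> (size s <= M)%N ->
  perm_eq s t -> pds s f = pds t f.
Proof.
move=> pf cf; elim: s t => [|i s IH] t sM st.
  by move: st; rewrite perm_sym => /perm_nilP ->.
have : i \in t by rewrite -(perm_mem st) mem_head.
move=> /splitPr ti; case: ti st => t1 t2 st.
have st' : perm_eq s (t1 ++ t2).
  rewrite -(perm_cons i) (perm_trans st)//.
  by rewrite -cat1s catA perm_sym -[i :: _]cat1s catA perm_cat2r perm_catC.
have sz : @size 'I_3 s = (@size 'I_3 t1 + @size 'I_3 t2)%N.
  by have := perm_size st'; rewrite size_cat.
have t2s : (@size 'I_3 t2 <= @size 'I_3 s)%N by rewrite sz leq_addl.
have t2M : (@size 'I_3 t2 < M)%N := leq_ltn_trans t2s sM.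
rewrite /= (IH _ (ltnW sM) st') !pds_cat.
apply: (@pd_pds_comm (M - size t2)); first exact: pds_periodic.
  exact: class_C_pds (ltnW t2M) cf.
have st1 : (@size 'I_3 t2 + @size 'I_3 t1 < M)%N by rewrite addnC -sz.
by rewrite ltn_subRL.
Qed.

Lemma count_mem_mpd M (i : mindex M) j :
  count_mem j (flatten [seq nseq (i k) k | k <- enum 'I_3]) = i j.
Proof.
rewrite count_flatten -map_comp sumnE big_map big_enum /= (bigD1 j)//=.
rewrite count_nseq /= eqxx mul1n big1 ?addn0// => k kj.
by rewrite count_nseq /= (negbTE kj).
Qed.

Lemma size_mpd M (i : mindex M) :
  size (flatten [seq nseq (i k) k | k <- enum 'I_3]) = mlen i.
Proof.
rewrite size_flatten /shape -map_comp sumnE big_map big_enum /=.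
by apply: eq_bigr => k _; rewrite size_nseq.
Qed.

Definition mindex_of M s : mindex M := [ffun j => inord (count_mem j s)].

Lemma perm_mindex_of M s : (size s <= M)%N ->
  perm_eq s (flatten [seq nseq (mindex_of M s k) k | k <- enum 'I_3]).
Proof.
move=> sM; apply/allP => j _ /=; rewrite count_mem_mpd ffunE inordK//.
by rewrite ltnS (leq_trans (count_size _ _)).
Qed.

Lemma mlen_mindex_of M s : (size s <= M)%N -> mlen (mindex_of M s) = size s.
Proof. by move=> sM; rewrite -size_mpd -(perm_size (perm_mindex_of sM)). Qed.

Lemma pds_mpd M M' s f : t3_periodic f -> class_C M f -> (size s <= M)%N ->
  (size s <= M')%N -> pds s f = mpd (mindex_of M' s) f.
Proof.
by move=> pf cf sM sM'; apply: (pds_perm pf cf) => //; exact: perm_mindex_of.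
Qed.

End symmetry_of_partial_derivatives.

(** * The Sobolev inequality on the torus *)

Section sobolev.
Context {R : realType}.
Implicit Types (v w : 'rV[R]_3 -> R).

Lemma L2sq_ge0 v : (0 <= L2sq v)%E.
Proof. by apply: integral_ge0 => q _; rewrite lee_fin sqr_ge0. Qed.

(** An infimum provides a member only below a strictly larger bound; the factor 2 and eta > 0 supply
    the strictness. *)
Lemma weak_mpd_of_Hsq N v (i : mindex N) (eta : R) : 0 < eta ->
  (Hsq N v <= (eta ^+ 2)%:E)%E -> (mlen i <= N)%N ->
  exists2 w, weak_mpd i v w & (L2sq w <= (2 * eta ^+ 2)%:E)%E.
Proof.
move=> eta0 hv iN; have pos (k : mindex N) :
    (0 <= ereal_inf [set L2sq w | w in weak_mpd k v])%E.
  by apply/ereal_infP => _ [w _ <-]; exact: L2sq_ge0.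
have le1 : (ereal_inf [set L2sq w | w in weak_mpd i v] <= (eta ^+ 2)%:E)%E.
  apply: le_trans hv; rewrite /Hsq (bigD1 i)//= leeDl//.
  by apply: sume_ge0 => k _; exact: pos.
have lt2 : (ereal_inf [set L2sq w | w in weak_mpd i v] < (2 * eta ^+ 2)%:E)%E.
  apply: le_lt_trans le1 _; rewrite lte_fin mulr2n mulrDl mul1r ltrDl.
  by rewrite exprn_gt0.
by have [_ [w wv <-] h] := ereal_inf_lt lt2; exists w => //; exact: ltW.
Qed.

(* [2 |w| <= eta + w^2 / eta] *)
Lemma torus_int_L2_bound w (K : 'rV[R]_3 -> R) (eta : R) : 0 < eta -> in_L2 w ->
  (L2sq w <= (2 * eta ^+ 2)%:E)%E -> continuous (K : _ -> R^o) ->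
  (forall x, `|K x| <= 1) -> `|torus_int (fun x => w x * K x)| <= 2 * eta.
Proof.
move=> eta0 [mw w2] hw cK K1.
pose g q := eta / 2 + (eta *+ 2)^-1 * (w (vec3 q)) ^+ 2.
have mw2 : measurable_fun (@cube R) (fun q => (w (vec3 q)) ^+ 2).
  exact: measurable_funX.
have iw2 : leb3.-integrable (@cube R) (EFin \o (fun q => (w (vec3 q)) ^+ 2)).
  apply/integrableP; split; first exact/measurable_EFinP.
  rewrite (eq_integral (fun q => ((w (vec3 q)) ^+ 2)%:E))// => q _.
  by rewrite /= ger0_norm ?sqr_ge0.
have ic : leb3.-integrable (@cube R) (EFin \o cst (eta / 2)).
  have := @leb3_integrable R (cst (eta / 2)); apply; exact: cst_continuous.
have iz : leb3.-integrable (@cube R)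
    (EFin \o (fun q => (eta *+ 2)^-1 * (w (vec3 q)) ^+ 2)).
  exact: (integrableZl measurable_cube _ iw2).
have ig : leb3.-integrable (@cube R) (EFin \o g).
  exact: (integrableD measurable_cube ic iz).
have wg q : `|w (vec3 q) * K (vec3 q)| <= g q.
  apply: (@le_trans _ _ `|w (vec3 q)|); first by rewrite normrM ler_piMr.
  have -> : g q = (eta ^+ 2 + `|w (vec3 q)| ^+ 2) / (eta *+ 2).
    rewrite /g real_normK ?num_real//; field; exact: lt0r_neq0.
  rewrite ler_pdivlMr ?mulrn_wgt0// -subr_ge0.
  have -> : eta ^+ 2 + `|w (vec3 q)| ^+ 2 - `|w (vec3 q)| * (eta *+ 2) =
    (eta - `|w (vec3 q)|) ^+ 2 by ring.
  exact: sqr_ge0.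
have mwK : measurable_fun (@cube R) (fun q => w (vec3 q) * K (vec3 q)).
  by apply: measurable_funM => //; apply: measurable_funTS; exact: measurable_vec3.
have iwK : leb3.-integrable (@cube R) (EFin \o (fun q => w (vec3 q) * K (vec3 q))).
  apply: le_integrable ig => //; first exact: measurable_cube.
    exact/measurable_EFinP.
  by move=> q _; rewrite lee_fin /= (le_trans (wg q)) ?ler_norm.
apply: le_trans (le_normr_Rintegral measurable_cube iwK) _.
apply: (@le_trans _ _ (Rintegral leb3 (@cube R) g)).
  apply: le_Rintegral => //; first exact: measurable_cube.
  exact: (integrable_norm iwK).
rewrite (RintegralD measurable_cube ic iz) (RintegralZl _ measurable_cube iw2).
rewrite Rintegral_cst; last exact: measurable_cube.
rewrite leb3_cube mulr1.
have hI : Rintegral leb3 (@cube R) (fun q => (w (vec3 q)) ^+ 2) <= 2 * eta ^+ 2.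
  rewrite /Rintegral -lee_fin fineK//.
  by rewrite ge0_fin_numE//; exact: L2sq_ge0.
apply: (@le_trans _ _ (eta / 2 + (eta *+ 2)^-1 * (2 * eta ^+ 2))).
  by rewrite lerD2l ler_wpM2l// invr_ge0 mulrn_wge0// ltW.
have -> : eta / 2 + (eta *+ 2)^-1 * (2 * eta ^+ 2) = 3 / 2 * eta.
  by field; exact: lt0r_neq0.
by rewrite ler_wpM2r ?(ltW eta0)//; lra.
Qed.

(** The kernel splits into 8 terms, one for each set A of directions, and each contributes at most 2
    eta: hence 16. A term uses a weak derivative of order |s| + |A| <= M + 3. *)
Lemma sobolev_sup N M v s (eta : R) : t3_periodic v -> class_C M v ->
  (size s <= M)%N -> (M + 3 <= N)%N -> 0 < eta ->
  (Hsq N v <= (eta ^+ 2)%:E)%E -> forall y, `|pds s v y| <= 16 * eta.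
Proof.
move=> pv cv sM MN eta0 hv y.
have cs : class_C 0 (pds s v) by apply: class_C_le (class_C_pds sM cv).
apply: torus_int_kernel3_bound; [exact/class_C0|exact: pds_periodic|] => n.
rewrite kernel3_sum.
pose P (A : {set 'I_3}) x := pds s v x * pds (enum A) (kernel3_prim n A y) x.
have cA (A : {set 'I_3}) : class_C 0 (pds (enum A) (kernel3_prim n A y)).
  have := class_C_pds (leqnn _) (class_C_kernel3_prim (size (enum A)) n A y).
  by rewrite subnn.
have -> : pds s v \* (fun x => \sum_(A : {set 'I_3}) pds (enum A) (kernel3_prim n A y) x) =
    (fun x => \sum_(A : {set 'I_3}) P A x).
  by apply/funext => x; rewrite /= mulr_sumr.
have cP A : continuous (P A : _ -> R^o).
  by apply/class_C0; exact: (class_CM cs (cA A)).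
rewrite (torus_int_sum _ cP).
apply: le_trans (ler_norm_sum _ _ _) _.
have -> : 16 * eta = \sum_(A : {set 'I_3}) (2 * eta).
  rewrite sumr_const -cardsT -powersetT card_powerset cardsT card_ord.
  by rewrite -mulr_natl; ring.
apply: ler_sum => A _; rewrite /P.
have tK j := @trig_kernel3_prim R n A j.
have pK : t3_periodic (pds (enum A) (kernel3_prim n A y)).
  exact/pds_periodic/kernel3_prim_periodic.
have cK : class_C M (pds (enum A) (kernel3_prim n A y)).
  have := class_C_pds (leq_addl M _) (class_C_kernel3_prim (M + size (enum A)) n A y).
  by rewrite addnK.
(* The classical derivatives [s] go onto the test function first, so that all |s| + |A| derivatives
   return to v at once as a single weak derivative and only the bounded primitive is left. *)
rewrite (torus_int_by_parts_pds pv pK sM cv cK) -pds_cat normrM normrX normrN1 expr1n mul1r.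
have szA : (size (rev s ++ enum A) <= N)%N.
  rewrite size_cat size_rev -cardE.
  apply: leq_trans (leq_add sM _) MN.
  by have := max_card (mem A); rewrite card_ord.
rewrite (pds_mpd (@kernel3_prim_periodic _ n A y)
  (class_C_kernel3_prim _ n A y) szA szA).
have mi : (mlen (mindex_of N (rev s ++ enum A)) <= N)%N by rewrite mlen_mindex_of.
have [w [v2 w2 hI] hw] := weak_mpd_of_Hsq eta0 hv mi.
rewrite (hI _ (@kernel3_prim_periodic _ n A y)
  (fun m => class_C_kernel3_prim m n A y)).
rewrite normrM normrX normrN1 expr1n mul1r.
apply: torus_int_L2_bound => //; last exact: kernel3_prim_le1.
exact/class_C0/class_C_kernel3_prim.
Qed.

End sobolev.

(** * Comparison of [Cnorm] with [bounded_C] *)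

Section Cnorm_bounds.
Context {R : realType}.
Implicit Types (f : 'rV[R]_3 -> R).

Lemma sup_abs_ge0 f :
  (0 <= ereal_sup [set (`|f x|)%:E | x in [set: 'rV[R]_3]])%E.
Proof.
apply: (@le_trans _ _ (`|f 0|)%:E); first by rewrite lee_fin.
by apply: ereal_sup_ubound; exists 0.
Qed.

Lemma Cnorm_ge0 M f : (0 <= Cnorm M f)%E.
Proof.
rewrite /Cnorm; case: ifP => // _; apply: sume_ge0 => i _; exact: sup_abs_ge0.
Qed.

Lemma bounded_C_of_Cnorm M f K : t3_periodic f -> (Cnorm M f <= K%:E)%E ->
  bounded_C M K f.
Proof.
rewrite /Cnorm => pf; case: asboolP => [cf|_]; last by rewrite leye_eq.
move=> hK; split=> // s x sM; rewrite -lee_fin; apply: le_trans hK.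
rewrite (pds_mpd pf cf sM sM) (bigD1 (mindex_of M s)) ?mlen_mindex_of//=.
apply: (@le_trans _ _
  (ereal_sup [set (`|mpd (mindex_of M s) f x|)%:E | x in [set: 'rV[R]_3]])).
  by apply: ereal_sup_ubound; exists x.
by rewrite leeDl//; apply: sume_ge0 => i _; exact: sup_abs_ge0.
Qed.

Lemma Cnorm_of_bounded_C M f K : bounded_C M K f ->
  (Cnorm M f <= (#|{: mindex M}|%:R * K)%:E)%E.
Proof.
move=> bf; have [cf hf] := bf; rewrite /Cnorm asboolT//.
apply: (@le_trans _ _ (\sum_(i : mindex M | (mlen i <= M)%N) K%:E)%E).
  apply: lee_sum => i iM; apply/ereal_supP => _ [x _ <-]; rewrite lee_fin.
  by apply: hf; rewrite size_mpd.
rewrite sumEFin lee_fin sumr_const -[leLHS]mulr_natl.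
by rewrite ler_wpM2r ?(bounded_C_ge0 bf)// ler_nat max_card.
Qed.

End Cnorm_bounds.

(** * Decay of the FLRW background *)

Section flrw_estimates.
Context {R : realType}.

Lemma powR_third_cube (x : R) : 0 <= x -> (x `^ 3^-1) ^+ 3 = x.
Proof.
by move=> x0; rewrite -powR_mulrn ?powR_ge0// -powRrM mulVf ?pnatr_eq0// powRr1.
Qed.

Variable B : flrw R.
Hypotheses (L0 : 0 < Lam B) (a0 : 0 < a_ini B).
Let H := hubble B.
Let c := flrw_coef B.

Lemma hubble_gt0 : 0 < hubble B.
Proof. by rewrite sqrtr_gt0 divr_gt0. Qed.

Lemma sqrt_3Lam : Num.sqrt (3 * Lam B) = 3 * hubble B.
Proof.
rewrite (_ : 3 * Lam B = (3 * hubble B) ^+ 2).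
  by rewrite sqrtr_sqr ger0_norm// mulr_ge0// ltW// hubble_gt0.
by rewrite exprMn sqr_sqrtr ?divr_ge0 ?(ltW L0)//; field.
Qed.

Lemma flrw_coef_ge1 : 1 <= flrw_coef B.
Proof.
rewrite -[leLHS]sqrtr1 ler_wsqrtr// lerDr divr_ge0 ?sqr_ge0// mulr_ge0//.
exact: ltW.
Qed.

(* a^3 / a_ini^3 *)
Definition flrw_vol (t : R) : R := c * sinh (3 * H * t) + cosh (3 * H * t).

Lemma flrw_aE t : flrw_a B t = a_ini B * flrw_vol t `^ 3^-1.
Proof. by rewrite /flrw_a sqrt_3Lam. Qed.

Lemma flrw_vol_ge t : 0 <= t -> expR (3 * H * t) <= flrw_vol t.
Proof.
move=> t0; rewrite /flrw_vol /sinh /cosh.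
have s0 : 0 <= 3 * H * t by rewrite !mulr_ge0// ltW// hubble_gt0.
have := flrw_coef_ge1; rewrite -/c.
have h : expR (- (3 * H * t)) <= expR (3 * H * t) by rewrite ler_expR; lra.
(* The volume exceeds e^{3Ht} by exactly half of this product. *)
move=> c1; have : 0 <= (c - 1) * (expR (3 * H * t) - expR (- (3 * H * t))).
  by rewrite mulr_ge0 ?subr_ge0.
by lra.
Qed.

Lemma flrw_vol_gt0 t : 0 <= t -> 0 < flrw_vol t.
Proof. by move=> /flrw_vol_ge; apply: lt_le_trans; exact: expR_gt0. Qed.

(** [Y] is the growing exponential in the volume [X], and Y - X = (c - 1) / 2 * e^{-3Ht}. For cube
    roots 1 <= u <= v one has 1/u - 1/v <= v - u <= v^3 - u^3. This crude bound already has the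
    order of the frame error. *)
Lemma flrw_a_inv t : 0 <= t ->
  `|(flrw_a B t)^-1 - flrw_einf B * expR (- H * t)| <=
  (a_ini B)^-1 * c * expR (- 3 * H * t).
Proof.
move=> t0; have c1 := flrw_coef_ge1; rewrite -/c in c1.
set X := flrw_vol t; pose Y := (2^-1 * c + 2^-1) * expR (3 * H * t).
have X1 : expR (3 * H * t) <= X := flrw_vol_ge t0.
have E1 : 1 <= expR (3 * H * t).
  by rewrite -[leLHS]expR0 ler_expR !mulr_ge0// ltW// hubble_gt0.
have XY : Y - X = (c - 1) / 2 * expR (- 3 * H * t).
  rewrite /Y /X /flrw_vol /sinh /cosh !mulNr; by field.
have XleY : X <= Y.
  by rewrite -subr_ge0 XY mulr_ge0 ?expR_ge0// divr_ge0// subr_ge0.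
have cube_root (Z : R) : 1 <= Z -> (Z `^ 3^-1) ^+ 3 = Z /\ 1 <= Z `^ 3^-1.
  move=> Z1; have Z0 : 0 <= Z by apply: le_trans Z1.
  have p1 : (1 : R) `^ 3^-1 = 1 by rewrite powR1.
  split; last by rewrite -[leLHS]p1 ge0_ler_powR ?nnegrE.
  exact: powR_third_cube.
have [u3 u1] := cube_root X (le_trans E1 X1).
have [v3 v1] := cube_root Y (le_trans E1 (le_trans X1 XleY)).
have uv : X `^ 3^-1 <= Y `^ 3^-1.
  have X0 : 0 <= X by apply: le_trans X1; exact: expR_ge0.
  by rewrite ge0_ler_powR ?nnegrE// (le_trans X0).
have -> : flrw_einf B * expR (- H * t) = (a_ini B)^-1 * (Y `^ 3^-1)^-1.
  rewrite /flrw_einf -mulrA; congr (_ * _).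
  rewrite powRN /Y powRM ?expR_ge0//; last by rewrite addr_ge0// mulr_ge0// (le_trans _ c1).
  rewrite -expRM (_ : 3 * H * t * 3^-1 = H * t); last by field.
  by rewrite mulNr expRN invfM.
rewrite flrw_aE -/X invfM -mulrBr normrM (gtr0_norm (_ : 0 < (a_ini B)^-1)) ?invr_gt0//.
rewrite -mulrA ler_wpM2l ?invr_ge0 ?(ltW a0)//.
move: u3 v3 u1 v1 uv; set u := X `^ _; set v := Y `^ _ => u3 v3 u1 v1 uv.
have u0 : 0 < u by apply: lt_le_trans u1.
have v0 : 0 < v by apply: lt_le_trans v1.
have -> : u^-1 - v^-1 = (v - u) / (u * v) by field; rewrite !gt_eqF.
rewrite ger0_norm; last by rewrite divr_ge0 ?subr_ge0// ltW// mulr_gt0.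
apply: (@le_trans _ _ (v - u)).
  rewrite ler_piMr ?subr_ge0// invf_le1 ?mulr_gt0//.
  by rewrite -[leLHS]mulr1 ler_pM.
apply: (@le_trans _ _ (Y - X)).
  have -> : Y - X = (v - u) * (v ^+ 2 + (u * v + u ^+ 2)) by rewrite -u3 -v3; ring.
  rewrite ler_peMr ?subr_ge0// (@le_trans _ _ (v ^+ 2)) ?exprn_ege1//.
  by rewrite lerDl addr_ge0 ?sqr_ge0// ltW// mulr_gt0.
rewrite XY ler_wpM2r ?expR_ge0//; lra.
Qed.

Lemma flrw_einf_gt0 : 0 < flrw_einf B.
Proof.
rewrite mulr_gt0 ?invr_gt0// powR_gt0// addr_gt0// mulr_gt0//.
exact: lt_le_trans flrw_coef_ge1.
Qed.

Lemma continuous_flrw_vol : continuous (flrw_vol : R -> R^o).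
Proof.
have -> : flrw_vol = (fun t => (c + 1) / 2 * expR (3 * H * t) +
    (1 - c) / 2 * expR (- (3 * H) * t)).
  by apply/funext => t; rewrite /flrw_vol /sinh /cosh mulNr; field.
have cE (k l t : R) : l * expR (k * s) @[s --> t] --> l * expR (k * t).
  apply: cvgM; first exact: cvg_cst.
  apply: (@continuous_comp _ _ _ (fun s => k * s) expR); last exact: continuous_expR.
  by apply: cvgM; [exact: cvg_cst|exact: cvg_id].
by move=> t; exact: (@cvgD _ R^o _ _ _ _ _ _ _ (cE _ _ t) (cE _ _ t)).
Qed.

(** The derivative is phi_ini * (a_ini / a)^3 = O(e^{-3Ht}), of which only e^{-2Ht} is kept.
    Differentiating the integral takes t in the interior of [0, t + 1]; the value at t = 0 is
    absorbed in the constant of [e0psi_estimate]. *)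
Lemma flrw_dtpsi_bound t : 0 < t ->
  `|flrw_dtpsi B t| <= `|phi_ini B| * expR (- 2 * H * t).
Proof.
move=> t0.
pose g s := (flrw_vol s)^-1.
pose F x := \int[lebesgue_measure]_(s in `[0, x]) g s.
have gE s : 0 <= s -> a_ini B ^+ 3 / flrw_a B s ^+ 3 = g s.
  move=> s0; rewrite flrw_aE exprMn powR_third_cube ?(ltW (flrw_vol_gt0 s0))//.
  by rewrite invfM mulrA divff ?mul1r// expf_neq0// gt_eqF.
have cg s : 0 <= s -> {for s, continuous (g : R -> R^o)}.
  move=> s0; apply: cvgV; first by rewrite gt_eqF// flrw_vol_gt0.
  exact: continuous_flrw_vol.
have ig : lebesgue_measure.-integrable `[0, t + 1] (EFin \o g).
  apply: continuous_compact_integrable; first exact: segment_compact.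
  apply: continuous_in_subspaceT => s /set_mem /=; rewrite in_itv /= => /andP[s0 _].
  exact: cg.
have tt : t < t + 1 by rewrite ltrDl.
have [dF F't] := continuous_FTC1_closed tt ig t0 (cg _ (ltW t0)).
have psiE : \near t, psi_ini B + phi_ini B * F t = flrw_psi B t.
  near=> x; have x0 : 0 < x by near: x; exact: lt_nbhsr.
  rewrite /flrw_psi /oint (ltW x0); congr (_ + _ * _).
  by apply: eq_Rintegral => s /set_mem /=; rewrite in_itv /= => /andP[s0 _]; rewrite gE.
have dpsi : is_derive t 1 (flrw_psi B : R -> R^o) (phi_ini B * g t).
  apply: near_eq_is_derive psiE _.
  have dF' : is_derive t 1 (F : R -> R^o) (g t).
    by split; [exact: dF|rewrite -derive1E; exact: F't].
  apply: is_derive_eq (is_deriveD (is_derive_cst (psi_ini B : R^o) t 1)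
    (is_deriveZ (phi_ini B) dF')) _.
  by rewrite add0r.
rewrite /flrw_dtpsi derive1E; have [_ ->] := dpsi.
rewrite normrM ler_wpM2l// gtr0_norm ?invr_gt0 ?flrw_vol_gt0 ?(ltW t0)//.
apply: (@le_trans _ _ (expR (3 * H * t))^-1).
  by rewrite lef_pV2 ?posrE ?expR_gt0 ?flrw_vol_gt0 ?flrw_vol_ge// ltW.
rewrite -expRN ler_expR -!mulNr ler_wpM2r ?(ltW t0)// ler_wpM2r ?(ltW hubble_gt0)//.
by lra.
Unshelve. all: by end_near.
Qed.

End flrw_estimates.

(** * The norm of a gradient in an orthonormal frame *)

Section orthonormal_frames.
Context {R : realType} {d : nat}.
Implicit Types (G : 'rV[R]_d -> 'M[R]_d) (p u v : 'rV[R]_d).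

Lemma dotE G p u v : dot G p u v = (u *m G p *m v^T) 0 0.
Proof.
rewrite /dot mxE exchange_big /=; apply: eq_bigr => j _.
rewrite !mxE mulr_suml; apply: eq_bigr => i _.
by rewrite [G p i j * _]mulrC.
Qed.

Lemma dotC G p u v : (G p)^T = G p -> dot G p u v = dot G p v u.
Proof.
move=> sG; rewrite !dotE -[in LHS]sG -[in LHS](trmxK u) -!trmx_mul mxE.
by rewrite mulmxA.
Qed.

(* If F G F^T = eta with eta^2 = 1, then the inverse of G is F^T eta F. *)
Lemma dot_grad_frame G (f : 'rV[R]_d -> R) p (e : 'I_d -> 'rV[R]_d)
    (s : 'I_d -> R) : (forall a, s a * s a = 1) ->
  (forall a b, dot G p (e a) (e b) = (a == b)%:R * s a) ->
  dot G p (grad G f p) (grad G f p) =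
  \sum_a s a * (\sum_i e a 0 i * pd i f p) ^+ 2.
Proof.
move=> ss orth; pose F := \matrix_a e a; pose eta := diag_mx (\row_a s a).
pose D := \row_i pd i f p.
have FGF : F *m G p *m F^T = eta.
  apply/matrixP => a b; rewrite [RHS]mxE [X in _ = X *+ _]mxE -mulr_natl -orth dotE.
  rewrite [LHS]mxE [RHS]mxE; apply: eq_bigr => j _; rewrite !mxE; congr (_ * _).
  by apply: eq_bigr => i _; rewrite !mxE.
have ee : eta *m eta = 1%:M.
  rewrite mulmx_diag; apply/matrixP => a b; rewrite !mxE ss.
  by [].
(* From F G F^T = eta, the matrix F^T is a right inverse of eta F G, hence also a left inverse, all
   matrices being square. *)
have h : F^T *m eta *m F *m G p = 1%:M.
  have : F^T *m (eta *m F *m G p) = 1%:M.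
    by apply: mulmx1C; rewrite -!mulmxA [F *m _]mulmxA FGF.
  by rewrite !mulmxA.
have uG : G p \in unitmx by have [] := mulmx1_unit h.
have inv : invmx (G p) = F^T *m eta *m F by rewrite -[LHS]mul1mx -h mulmxK.
have gE : grad G f p = D *m (invmx (G p))^T.
  by apply/rowP => i; rewrite !mxE; apply: eq_bigr => j _; rewrite !mxE mulrC.
have sI : (invmx (G p))^T = invmx (G p).
  by rewrite inv !trmx_mul trmxK tr_diag_mx mulmxA.
rewrite dotE gE sI trmx_mul sI mulmxKV//.
rewrite (_ : D *m _ = (D *m F^T) *m eta *m (D *m F^T)^T); last first.
  by rewrite trmx_mul trmxK inv !mulmxA.
rewrite mul_mx_diag !mxE; apply: eq_bigr => a _; rewrite !mxE.
have -> : \sum_j D 0 j * F^T j a = \sum_i e a 0 i * pd i f p.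
  by apply: eq_bigr => i _; rewrite !mxE mulrC.
by rewrite expr2 mulrA [s a * _]mulrC.
Qed.

End orthonormal_frames.

(** * Restriction of spacetime quantities to the slices *)

Section slices_of_spacetime.
Context {R : realType}.
Variable S : spacetime R.
Implicit Types (t : R) (x : 'rV[R]_3) (f : 'rV[R]_(1 + 3) -> R).

Lemma pt_shift t x (i : 'I_3) (h : R) :
  pt t (h *: delta_mx 0 i + x) = h *: delta_mx 0 (space_ix i) + pt t x.
Proof.
rewrite /pt /space_ix delta_mx_rshift scale_row_mx add_row_mx scaler0.
by rewrite add0r.
Qed.

Lemma pd_pt f t i x : pd (space_ix i) f (pt t x) = pd i (fun y => f (pt t y)) x.
Proof.
rewrite /pd /derive.
set F := (X in lim (X @ _) = _); set G := (X in _ = lim (X @ _)).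
suff -> : F = G by [].
by apply/funext => h; rewrite /F /G /= pt_shift.
Qed.

Lemma along_e0E f p : along (e0 S) f p = (lapse S p)^-1 * pd time_ix f p.
Proof.
rewrite /along big_split_ord /= big_ord1 row_mxEl mxE eqxx mulr1n big1 ?addr0//.
by move=> i _; rewrite row_mxEr mxE mul0r.
Qed.

Lemma along_eIE f (I : 'I_3) t x : along (eI S I) f (pt t x) =
  \sum_i sframe S I (pt t x) 0 i * pd i (fun y => f (pt t y)) x.
Proof.
rewrite /along big_split_ord /= big_ord1 row_mxEl mxE mul0r add0r.
by apply: eq_bigr => i _; rewrite row_mxEr -pd_pt.
Qed.

Lemma stmetric_sym p : (smetric S p)^T = smetric S p ->
  (stmetric S p)^T = stmetric S p.
Proof. by move=> sg; rewrite /stmetric tr_block_mx !trmx0 tr_scalar_mx sg. Qed.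

(** Identifies the estimated expression with the metric norm of the gradient, so that its sign
    decides the causal character. *)
Lemma dot_grad_stmetric B D t x : development S B D -> 0 <= t ->
  dot (stmetric S) (pt t x) (grad (stmetric S) (sfield S) (pt t x))
    (grad (stmetric S) (sfield S) (pt t x)) =
  - (along (e0 S) (sfield S) (pt t x)) ^+ 2 +
  \sum_I (along (eI S I) (sfield S) (pt t x)) ^+ 2.
Proof.
move=> [_ pos _ _ [_ orth _ _]] t0; set p := pt t x.
have [h00 h0I hIJ] := orth t x t0.
have sG : (stmetric S p)^T = stmetric S p.
  by apply: stmetric_sym; have [_ []] := pos t x t0.
pose e (a : 'I_(1 + 3)) :=
  match fintype.split a with inl _ => e0 S p | inr J => eI S J p end.
pose s (a : 'I_(1 + 3)) : R :=
  match fintype.split a with inl _ => -1 | inr _ => 1 end.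
rewrite (@dot_grad_frame _ _ _ _ _ e s); last 2 first.
- by move=> a; rewrite /s; case: splitP => _ _; rewrite ?mulrNN mulr1.
- move=> a b; rewrite -(can_eq (@splitK 1 3)) /e /s.
  move: (fintype.split a) (fintype.split b) => [i|I] [j|J] /=.
  + by rewrite (ord1 i) (ord1 j) eqxx mul1r.
  + by rewrite mul0r.
  + by rewrite mul0r dotC.
  + by rewrite hIJ mulr1.
rewrite big_split_ord /= big_ord1 /s /e.
have -> : fintype.split (lshift 3 (ord0 : 'I_1)) = inl ord0 by exact: (unsplitK (inl _)).
rewrite mulN1r; congr (_ + _); apply: eq_bigr => I _.
have -> : fintype.split (rshift 1 I) = inr I by exact: (unsplitK (inr _)).
by rewrite mul1r.
Qed.

Lemma pt_periodic t x (i : 'I_3) :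
  pt t (x + delta_mx 0 i) = pt t x + delta_mx 0 (space_ix i).
Proof.
by rewrite addrC -[delta_mx 0 i]scale1r pt_shift scale1r addrC.
Qed.

Lemma sfield_periodic t : regular S -> t3_periodic (fun x => sfield S (pt t x)).
Proof.
by move=> [per _ _ _ _] i x; rewrite pt_periodic; have [] := per i (pt t x).
Qed.

Lemma sframe_periodic I i t : regular S ->
  t3_periodic (fun x => sframe S I (pt t x) 0 i).
Proof.
move=> [per _ _ _ _] j x; rewrite pt_periodic.
by have [_ _ _ ->] := per j (pt t x).
Qed.

Lemma along_e0_periodic t : regular S ->
  t3_periodic (fun x => along (e0 S) (sfield S) (pt t x)).
Proof.
move=> [per _ _ _ _] i x; rewrite !along_e0E pt_periodic.
have [-> _ _ _] := per i (pt t x); congr (_ * _).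
by apply: pd_shift => p; have [] := per i p.
Qed.

End slices_of_spacetime.

(** * Expansion of the squared norm in powers of q *)

Section gradient_estimate.
Context {R : realType}.

(** With Q the sum of the E P, the sum of the e p is q Q + T with T = O(q^3), so the difference of
    squares is 2 q Q T + T^2. Here K precedes q and the functions, which makes it uniform in time
    and in the solution. *)
Lemma frame_derivative_estimate M (K1 K2 K3 K4 : R) :
  0 <= K1 -> 0 <= K2 -> 0 <= K3 -> 0 <= K4 ->
  exists2 K, 0 <= K & forall (q : R) (E P e p : 'I_3 -> 'rV[R]_3 -> R),
    0 <= q <= 1 ->
    (forall a, bounded_C M K1 (E a)) -> (forall a, bounded_C M K2 (P a)) ->
    (forall a, bounded_C M (K3 * q ^+ 3) (fun x => e a x - q * E a x)) ->
    (forall a, bounded_C M (K4 * q ^+ 2) (fun x => p a x - P a x)) ->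
    bounded_C M (K * q ^+ 4) (fun x => (\sum_a e a x * p a x) ^+ 2
                                       - q ^+ 2 * (\sum_a E a x * P a x) ^+ 2).
Proof.
move=> K10 K20 K30 K40; pose c : R := 2 ^+ M; have c0 : 0 <= c by exact: exprn_ge0.
pose KQ := \sum_(a < 3) c * (K1 * K2).
pose KT := \sum_(a < 3) (c * (K1 * K4) + c * (K3 * (K4 + K2))).
have KQ0 : 0 <= KQ by apply: sumr_ge0 => a _; rewrite !mulr_ge0.
have KT0 : 0 <= KT by apply: sumr_ge0 => a _; rewrite addr_ge0 ?mulr_ge0 ?addr_ge0.
exists (2 * (c * (KQ * KT)) + c * (KT * KT)).
  by rewrite addr_ge0 ?mulr_ge0.
move=> q E P e p q01 bE bP be bp; have /andP[q0 q1] := q01.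
pose Q x := \sum_a E a x * P a x.
(* In e p - q E P = q E (p - P) + (e - q E) p, the last p is written (p - P) + P because only these
   two pieces have bounds. *)
pose T x := \sum_a (q * (E a x * (p a x - P a x)) +
  (e a x - q * E a x) * ((p a x - P a x) + P a x)).
have bQ : bounded_C M KQ Q by apply: bounded_C_sum => a; exact: bounded_CM.
have bT : bounded_C M (KT * q ^+ 3) T.
  rewrite mulr_suml; apply: bounded_C_sum => a; rewrite mulrDl.
  apply: bounded_CD.
    have -> : c * (K1 * K4) * q ^+ 3 = `|q| * (c * (K1 * (K4 * q ^+ 2))).
      by rewrite ger0_norm//; ring.
    by apply: bounded_CZ; exact: bounded_CM.
  apply: bounded_C_le (bounded_CM (be a) (bounded_CD (bp a) (bP a))) => //.
  have -> : c * (K3 * (K4 + K2)) * q ^+ 3 = c * (K3 * q ^+ 3 * (K4 + K2)) by ring.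
  rewrite ler_wpM2l// ler_wpM2l ?mulr_ge0 ?exprn_ge0// lerD2r.
  by rewrite ler_piMr// exprn_ile1.
have -> : (fun x => (\sum_a e a x * p a x) ^+ 2 - q ^+ 2 * (\sum_a E a x * P a x) ^+ 2)
    = (fun x => (2 * q) * (Q x * T x)) \+ (fun x => T x * T x).
  apply/funext => x /=; have -> : \sum_a e a x * p a x = q * Q x + T x.
    rewrite /Q /T mulr_sumr -big_split /=; apply: eq_bigr => a _; ring.
  by rewrite -/(Q x); ring.
rewrite mulrDl; apply: bounded_CD.
  have -> : 2 * (c * (KQ * KT)) * q ^+ 4 = `|2 * q| * (c * (KQ * (KT * q ^+ 3))).
    by rewrite ger0_norm ?mulr_ge0//; ring.
  by apply: bounded_CZ; exact: bounded_CM.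
apply: bounded_C_le (bounded_CM bT bT) => //.
have -> : c * (KT * KT) * q ^+ 4 = c * (KT * KT * q ^+ 4) by ring.
have -> : KT * q ^+ 3 * (KT * q ^+ 3) = KT * KT * q ^+ 6 by ring.
by rewrite ler_wpM2l// ler_wpM2l ?mulr_ge0// ler_wiXn2l.
Qed.

Lemma gradient_estimate M (K0 K1 K2 K3 K4 : R) :
  0 <= K0 -> 0 <= K1 -> 0 <= K2 -> 0 <= K3 -> 0 <= K4 ->
  exists2 K, 0 <= K & forall (q : R) (A : 'rV[R]_3 -> R)
      (E e : 'I_3 -> 'I_3 -> 'rV[R]_3 -> R) (P p : 'I_3 -> 'rV[R]_3 -> R),
    0 <= q <= 1 -> bounded_C M (K0 * q ^+ 2) A ->
    (forall I a, bounded_C M K1 (E I a)) -> (forall a, bounded_C M K2 (P a)) ->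
    (forall I a, bounded_C M (K3 * q ^+ 3) (fun x => e I a x - q * E I a x)) ->
    (forall a, bounded_C M (K4 * q ^+ 2) (fun x => p a x - P a x)) ->
    bounded_C M (K * q ^+ 4) (fun x =>
      - A x ^+ 2 + \sum_I (\sum_a e I a x * p a x) ^+ 2
      - (\sum_I \sum_a \sum_b E I a x * E I b x * P a x * P b x) * q ^+ 2).
Proof.
move=> K00 K10 K20 K30 K40.
have [K' K'0 hK'] := frame_derivative_estimate M K10 K20 K30 K40.
exists (2 ^+ M * (K0 * K0) + \sum_(I < 3) K').
  by rewrite addr_ge0 ?mulr_ge0 ?exprn_ge0 ?sumr_ge0.
move=> q A E e P p q01 bA bE bP be bp.
have -> : (fun x => - A x ^+ 2 + \sum_I (\sum_a e I a x * p a x) ^+ 2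
      - (\sum_I \sum_a \sum_b E I a x * E I b x * P a x * P b x) * q ^+ 2) =
    (fun x => - (A x * A x)) \+ (fun x => \sum_I ((\sum_a e I a x * p a x) ^+ 2
      - q ^+ 2 * (\sum_a E I a x * P a x) ^+ 2)).
  apply/funext => x /=; rewrite -expr2 -addrA; congr (_ + _).
  rewrite sumrB mulr_suml; congr (_ - _); apply: eq_bigr => I _.
  rewrite mulrC; congr (_ * _); rewrite expr2 big_distrlr /=.
  by apply: eq_bigr => a _; apply: eq_bigr => b _; ring.
rewrite mulrDl; apply: bounded_CD.
  have -> : 2 ^+ M * (K0 * K0) * q ^+ 4 = 2 ^+ M * (K0 * q ^+ 2 * (K0 * q ^+ 2)).
    by ring.
  exact/bounded_CN/bounded_CM.
by rewrite mulr_suml; apply: bounded_C_sum => I; exact: hK'.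
Qed.

End gradient_estimate.

(** * Bounds uniform over all solutions with [eps] at most [eps1] *)

Section perturbed_solutions.
Context {R : realType}.

Lemma subn4_succ N : (5 <= N)%N -> (N - 4 = (N - 5).+1)%N.
Proof. lia. Qed.

Lemma subn4_leq N : (5 <= N)%N -> (N - 4 + 3 <= N)%N.
Proof. lia. Qed.

Lemma Hsq_ge0 N (v : 'rV[R]_3 -> R) : (0 <= Hsq N v)%E.
Proof.
apply: sume_ge0 => i _; apply/ereal_infP => _ [w _ <-]; exact: L2sq_ge0.
Qed.

Lemma adde_le_parts (x y z : \bar R) : (0 <= x)%E -> (0 <= y)%E ->
  (x + y <= z)%E -> (x <= z)%E /\ (y <= z)%E.
Proof.
by move=> x0 y0 xyz; split; apply: le_trans xyz; rewrite ?leeDl ?leeDr.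
Qed.

Variables (N : nat) (B : flrw R) (C0 : R) (eps1 : R).
Hypotheses (hN : (5 <= N)%N) (hLam : 0 < Lam B) (ha : 0 < a_ini B).
Hypotheses (hC0 : 0 < C0) (eps1_gt0 : 0 < eps1).
Variables (D : data R) (S : spacetime R) (eps : R).
Variables (psinf : 'rV[R]_3 -> R) (ehinf : 'I_3 -> 'I_3 -> 'rV[R]_3 -> R).
Hypothesis sol : perturbed_global_solution N B C0 eps D S psinf ehinf.
Hypothesis eps_le : eps <= eps1.
Let H := hubble B.

Lemma solution_regular : regular S.
Proof. by have [[_ []]] := sol. Qed.

Lemma initial_parts : (forall I i, Hsq N (hat_e S B I i 0) <= (eps1 ^+ 2)%:E)%E /\
  (Hsq N (hat_psi S B 0) <= (eps1 ^+ 2)%:E)%E.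
Proof.
have [_ [e0 hs] _ _ _] := sol.
have s2 (F : 'I_3 -> 'I_3 -> \bar R) : (forall I J, 0 <= F I J)%E ->
    (0 <= \sum_I \sum_J F I J)%E.
  by move=> F0; apply: sume_ge0 => I _; apply: sume_ge0 => J _.
have hk : (0 <= Hsq_k S N 0)%E by apply: s2 => I J; exact: Hsq_ge0.
have hg : (0 <= Hsq_gam S N 0)%E.
  by apply: s2 => I J; apply: sume_ge0 => K _; exact: Hsq_ge0.
have he : (0 <= Hsq_e S B N 0)%E by apply: s2 => I J; exact: Hsq_ge0.
have hp : (0 <= Hsq_epsi S B N 0)%E.
  by apply: adde_ge0; [exact: Hsq_ge0|apply: sume_ge0 => I _; exact: Hsq_ge0].
have hn : (0 <= Hsq N (hat_n S 0))%E := Hsq_ge0 N _.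
have : (initial_size S B N <= (eps1 ^+ 2)%:E)%E.
  by rewrite hs lee_fin lerXn2r ?nnegrE// ltW.
have kg := adde_ge0 hk hg; have kge := adde_ge0 kg he.
have kgen := adde_ge0 kge hn; have kgenp := adde_ge0 kgen hp.
move=> /(adde_le_parts kgenp (Hsq_ge0 N _))[] /(adde_le_parts kgen hp)[]
  /(adde_le_parts kge hn)[] /(adde_le_parts kg he)[] _ h _ _ hpsi.
split; last exact: hpsi.
move=> I i; apply: le_trans h; rewrite /Hsq_e (bigD1 I)//= (bigD1 i)//= -addeA leeDl//.
apply: adde_ge0; first by apply: sume_ge0 => j _; exact: Hsq_ge0.
by apply: sume_ge0 => J _; apply: sume_ge0 => j _; exact: Hsq_ge0.
Qed.

Lemma hat_e_periodic I i t : t3_periodic (hat_e S B I i t).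
Proof.
move=> j x; rewrite /hat_e; congr (_ - _).
exact: (sframe_periodic _ _ _ solution_regular).
Qed.

Lemma hat_e_estimate I i t : 0 <= t -> bounded_C (N - 4) (C0 * eps * expR (- 3 * H * t))
  (fun x => hat_e S B I i t x - ehinf I i x * expR (- H * t)).
Proof.
move=> t0; have [_ _ _ _ he] := sol; have [pe _ _ /(_ t t0) h] := he I i.
apply: bounded_C_of_Cnorm h => j x; rewrite pe; congr (_ - _).
exact: hat_e_periodic.
Qed.

Lemma sfield_estimate t : 0 <= t -> bounded_C (N - 4) (C0 * expR (- 2 * H * t))
  (fun x => sfield S (pt t x) - psinf x).
Proof.
move=> t0; have [_ _ _ [pp _ /(_ t t0) h] _] := sol.
apply: bounded_C_of_Cnorm h => j x; rewrite pp; congr (_ - _).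
exact: (sfield_periodic _ solution_regular).
Qed.

Lemma hat_e0psi_estimate t : 0 <= t ->
  bounded_C (N - 4) (C0 * eps * expR (- 2 * H * t)) (hat_e0psi S B t).
Proof.
move=> t0; have [_ _ /(_ t t0)[_ h] _ _] := sol.
apply: bounded_C_of_Cnorm.
  move=> j x; rewrite /hat_e0psi; congr (_ - _).
  exact: (along_e0_periodic _ solution_regular).
apply: le_trans h; rewrite leeDr// adde_ge0 ?Cnorm_ge0//.
exact: sqrte_ge0.
Qed.

(** At t = 0 the frame difference is at most 16 eps1 by the Sobolev inequality, and its distance to
    the limit is at most C0 eps1. Both are small with eps1, which keeps the limit frame
    invertible. *)
Lemma ehinf_bound I i : bounded_C (N - 4) ((16 + C0) * eps1) (ehinf I i).
Proof.
have [_ _ _ _ he] := sol; have [pe ce _ _] := he I i.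
have := hat_e_estimate I i (lexx 0); rewrite !mulr0 expR0 !mulr1.
have -> : (fun x => hat_e S B I i 0 x - ehinf I i x * 1) =
    hat_e S B I i 0 \- ehinf I i.
  by apply/funext => x; rewrite mulr1.
move=> hd; have he0 : hat_e S B I i 0 = (hat_e S B I i 0 \- ehinf I i) \+ ehinf I i.
  by apply/funext => x; rewrite /= subrK.
have ch : class_C (N - 4) (hat_e S B I i 0).
  by rewrite he0; apply: class_CD ce; have [] := hd.
have bh : bounded_C (N - 4) (16 * eps1) (hat_e S B I i 0).
  split=> // s x sM.
  have N3 := subn4_leq hN.
  exact: (sobolev_sup (@hat_e_periodic I i 0) ch sM N3 eps1_gt0
    (initial_parts.1 I i)).
have -> : ehinf I i = hat_e S B I i 0 \- (hat_e S B I i 0 \- ehinf I i).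
  by apply/funext => x; rewrite /= subKr.
apply: bounded_C_le (bounded_CB bh hd) => //.
by rewrite [leRHS]mulrDl lerD2l ler_pM2l.
Qed.

Lemma einf_bound I i :
  bounded_C (N - 4) ((16 + C0) * eps1 + flrw_einf B) (einf B ehinf I i).
Proof.
have e0 := flrw_einf_gt0 hLam ha.
apply: bounded_C_le (bounded_CD (ehinf_bound I i)
  (bounded_C_cst (N - 4) ((I == i)%:R * flrw_einf B))) => //.
rewrite lerD2l normrM (gtr0_norm e0) ler_piMl ?(ltW e0)//.
by case: eqP => _; rewrite ?normr1 ?normr0.
Qed.

(** The same comparison at t = 0, but here the distance to the limit is only bounded by C0.
    Differentiating removes the background constant [flrw_psi B 0]. *)
Lemma pd_psinf_bound a : bounded_C (N - 5) (16 * eps1 + C0) (pd a psinf).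
Proof.
have [_ _ _ [pp cp _] _] := sol.
have NE := subn4_succ hN.
have := sfield_estimate (lexx 0); rewrite !mulr0 expR0 mulr1 => hd.
have ch : class_C (N - 4) (hat_psi S B 0).
  have -> : hat_psi S B 0 = ((fun x => sfield S (pt 0 x) - psinf x) \+ psinf)
      \+ cst (- flrw_psi B 0).
    by apply/funext => x; rewrite /hat_psi /= subrK.
  apply: class_CD (class_C_cst _ _); apply: class_CD cp; exact: hd.1.
have ph : t3_periodic (hat_psi S B 0).
  move=> j x; rewrite /hat_psi; congr (_ - _).
  exact: (sfield_periodic _ solution_regular).
have bh : bounded_C (N - 4) (16 * eps1) (hat_psi S B 0).
  split=> // s x sM.
  have N3 := subn4_leq hN.
  exact: (sobolev_sup ph ch sM N3 eps1_gt0 initial_parts.2).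
have bd := bounded_CB bh hd.
have E : psinf = (hat_psi S B 0 \- (fun x => sfield S (pt 0 x) - psinf x))
    \+ cst (flrw_psi B 0).
  by apply/funext => x; rewrite /hat_psi /=; ring.
rewrite NE in bd; have := bounded_C_pd a bd; congr (bounded_C _ _ _).
have [/class_CS[_ df _] _] := bd.
rewrite [in RHS]E (pdD (df a)); last by move=> p; exact: derivable_cst.
by rewrite pd_cst; apply/funext => x; rewrite /= addr0.
Qed.

Lemma expR_natH (n : nat) t : expR (- n%:R * H * t) = expR (- H * t) ^+ n.
Proof. by rewrite -expRM_natl; congr expR; ring. Qed.

Lemma frame_estimate I a t : 0 <= t -> bounded_C (N - 4)
  ((C0 * eps1 + (a_ini B)^-1 * flrw_coef B) * expR (- H * t) ^+ 3)
  (fun x => sframe S I (pt t x) 0 a - expR (- H * t) * einf B ehinf I a x).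
Proof.
move=> t0; pose r := (I == a)%:R * ((flrw_a B t)^-1 - flrw_einf B * expR (- H * t)).
have -> : (fun x => sframe S I (pt t x) 0 a - expR (- H * t) * einf B ehinf I a x) =
    (fun x => hat_e S B I a t x - ehinf I a x * expR (- H * t)) \+ cst r.
  by apply/funext => x; rewrite /hat_e /flrw_e /einf /r /=; ring.
rewrite mulrDl; apply: bounded_C_le (bounded_CD (hat_e_estimate I a t0)
  (bounded_C_cst (N - 4) r)) => //.
rewrite -(expR_natH 3); apply: lerD.
  by rewrite ler_wpM2r ?expR_ge0// ler_wpM2l// ltW.
apply: le_trans (flrw_a_inv hLam ha t0).
rewrite /r normrM ler_piMl//.
by case: eqP => _; rewrite ?normr1 ?normr0.
Qed.

Lemma e0psi_estimate t : 0 <= t -> bounded_C (N - 4)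
  ((C0 * eps1 + (`|phi_ini B| + `|flrw_dtpsi B 0|)) * expR (- H * t) ^+ 2)
  (fun x => along (e0 S) (sfield S) (pt t x)).
Proof.
move=> t0.
have -> : (fun x => along (e0 S) (sfield S) (pt t x)) =
    hat_e0psi S B t \+ cst (flrw_dtpsi B t).
  by apply/funext => x; rewrite /hat_e0psi /= subrK.
rewrite mulrDl; apply: bounded_C_le (bounded_CD (hat_e0psi_estimate t0)
  (bounded_C_cst (N - 4) (flrw_dtpsi B t))) => //.
rewrite -(expR_natH 2); apply: lerD.
  by rewrite ler_wpM2r ?expR_ge0// ler_wpM2l// ltW.
rewrite mulrDl; have := t0; rewrite le_eqVlt => /predU1P[<-|t1].
  by rewrite !mulr0 expR0 !mulr1 lerDr.
apply: le_trans (flrw_dtpsi_bound hLam ha t1) _.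
by rewrite lerDl mulr_ge0 ?expR_ge0.
Qed.

Lemma pd_sfield_estimate a t : 0 <= t ->
  bounded_C (N - 5) (C0 * expR (- H * t) ^+ 2)
    (fun x => pd a (fun y => sfield S (pt t y)) x - pd a psinf x).
Proof.
move=> t0; have NE := subn4_succ hN.
have := sfield_estimate t0; rewrite NE => bd.
have [_ _ _ [_ cp _] _] := sol; rewrite NE in cp.
have /class_CS[_ dd _] := bd.1; have /class_CS[_ dp _] := cp.
have := bounded_C_pd a bd; rewrite -(expR_natH 2); congr (bounded_C _ _ _).
have E : (fun y => sfield S (pt t y)) =
    (fun y => sfield S (pt t y) - psinf y) \+ psinf.
  by apply/funext => y; rewrite /= subrK.
by rewrite [in RHS]E (pdD (dd a) (dp a)); apply/funext => x; rewrite /= addrK.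
Qed.

(* The frame (e_I^i)^infty is a small perturbation of a multiple of the
   identity, hence invertible. *)
Lemma einf_nondegenerate x (v : 'I_3 -> R) :
  6 * ((16 + C0) * eps1) <= flrw_einf B -> (exists i, v i != 0) ->
  0 < \sum_I (\sum_a einf B ehinf I a x * v a) ^+ 2.
Proof.
move=> small [i0 vi0]; rewrite lt_neqAle sumr_ge0 ?andbT; last first.
  by move=> I _; exact: sqr_ge0.
apply/eqP => /esym/eqP; rewrite psumr_eq0; last by move=> I _; exact: sqr_ge0.
move=> /allP P0.
have {}P0 I : \sum_a einf B ehinf I a x * v a = 0.
  by apply/eqP; have := P0 I (mem_index_enum I); rewrite sqrf_eq0.
(* Row I of the kernel equation, at an entry of v of largest modulus, gives [flrw_einf B] <= 3 k
   with k = (16 + C0) eps1, against 6 k <= [flrw_einf B]. *)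
pose I := [arg max_(i > i0) `|v i|]%O.
have Imax a : `|v a| <= `|v I|.
  by rewrite /I; case: arg_maxP => // i _; exact.
have vI : 0 < `|v I| by apply: lt_le_trans (Imax i0); rewrite normr_gt0.
have e0 := flrw_einf_gt0 hLam ha.
have k0 : 0 <= (16 + C0) * eps1 := bounded_C_ge0 (ehinf_bound I I).
have : flrw_einf B * v I = - \sum_a ehinf I a x * v a.
  apply/eqP; rewrite -addr_eq0 -[X in _ == X](P0 I) addrC /einf.
  under [X in _ == X]eq_bigr do rewrite mulrDl.
  rewrite big_split /= (inj_eq (addrI _)) (bigD1 I)//= eqxx mul1r big1 ?addr0//.
  by move=> a aI; rewrite eq_sym (negbTE aI) !mul0r.
move=> /(congr1 (fun r => `|r|)); rewrite normrN normrM (gtr0_norm e0) => E.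
have : flrw_einf B * `|v I| <= \sum_(a < 3) ((16 + C0) * eps1) * `|v I|.
  rewrite E; apply: le_trans (ler_norm_sum _ _ _) _; apply: ler_sum => a _.
  rewrite normrM ler_pM//; have [_ /(_ [::] x isT)] := ehinf_bound I a; exact.
rewrite sumr_const card_ord -mulrnAl ler_pM2r// => h.
have : 6 * ((16 + C0) * eps1) <= ((16 + C0) * eps1) *+ 3 := le_trans small h.
have := lt_le_trans e0 h; lra.
Qed.

Lemma Cnorm_cvg0 M K (f : R -> 'rV[R]_3 -> R) :
  (forall t, 0 <= t -> (Cnorm M (f t) <= (K * expR (- H * t) ^+ 2)%:E)%E) ->
  Cnorm M (f t) @[t --> +oo] --> 0%E.
Proof.
move=> hf; apply: (@squeeze_cvge _ _ _ _ (fun=> 0%E) _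
  (fun t => (K * expR (- H * t) ^+ 2)%:E)).
- by near=> t; rewrite Cnorm_ge0 hf.
- exact: cvg_cst.
have q0 : expR (- H * t) @[t --> +oo] --> (0 : R).
  under eq_fun do rewrite mulNr.
  apply: (@cvg_comp _ _ _ (fun t => H * t) (fun y => expR (- y))); last exact: cvgr_expR.
  exact: gt0_cvgMry (hubble_gt0 hLam) cvg_id.
apply: cvg_EFin; first by near=> t.
rewrite /comp /= -(mulr0 K); apply: cvgM; first exact: cvg_cst.
by rewrite -(mulr0 0); exact: (cvgM q0 q0).
Unshelve. all: by end_near.
Qed.

End perturbed_solutions.

Theorem corollary1p6 (R : realType) (N : nat) (B : flrw R) (C0 : R)
    (hN : (5 <= N)%N) (hLam : 0 < Lam B) (ha : 0 < a_ini B) (hC0 : 0 < C0) :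
  exists eps0 C : R, [/\ 0 < eps0, 0 < C &
    forall (D : data R) (S : spacetime R) (eps : R)
           (psinf : 'rV[R]_3 -> R) (ehinf : 'I_3 -> 'I_3 -> 'rV[R]_3 -> R),
      perturbed_global_solution N B C0 eps D S psinf ehinf ->
      eps <= eps0 ->
      [/\ Cnorm (N - 4) (fun x => sfield S (pt t x) - psinf x)
            @[t --> +oo] --> 0%E,
          forall I a, class_C (N - 4) (einf B ehinf I a) /\
            Cnorm (N - 4)
                (fun x => expR (hubble B * t) * sframe S I (pt t x) 0 a
                          - einf B ehinf I a x)
              @[t --> +oo] --> 0%E,
          forall t, 0 <= t ->
            (Cnorm (N - 5)
               (fun x =>
                  - (along (e0 S) (sfield S) (pt t x)) ^+ 2
                  + \sum_I (along (eI S I) (sfield S) (pt t x)) ^+ 2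
                  - (\sum_I \sum_a \sum_b
                       einf B ehinf I a x * einf B ehinf I b x
                       * pd a psinf x * pd b psinf x)
                    * expR (- 2 * hubble B * t))%R
             <= (C * expR (- 4 * hubble B * t))%:E)%E &
          forall x, (exists i, pd i psinf x != 0) ->
            exists T : R, forall t, T <= t ->
              0 < dot (stmetric S) (pt t x)
                    (grad (stmetric S) (sfield S) (pt t x))
                    (grad (stmetric S) (sfield S) (pt t x))]].
Proof.
have einf0 := flrw_einf_gt0 hLam ha; have c1 := flrw_coef_ge1 hLam.
have H0 := hubble_gt0 hLam.
have C16 : 0 < 16 + C0 by rewrite addr_gt0.
(* The largest value for which the smallness condition of [einf_nondegenerate] holds. *)
pose eps0 := flrw_einf B / (6 * (16 + C0)).
have eps0_gt0 : 0 < eps0 by rewrite divr_gt0// mulr_gt0.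
have small : 6 * ((16 + C0) * eps0) <= flrw_einf B.
  by rewrite /eps0 mulrA mulrC divfK// gt_eqF// mulr_gt0.
have [] := @gradient_estimate R (N - 5)
  (C0 * eps0 + (`|phi_ini B| + `|flrw_dtpsi B 0|))
  ((16 + C0) * eps0 + flrw_einf B) (16 * eps0 + C0)
  (C0 * eps0 + (a_ini B)^-1 * flrw_coef B) C0.
- by rewrite !addr_ge0// mulr_ge0 ?ltW.
- by rewrite ltW// addr_gt0// mulr_gt0.
- by rewrite ltW// addr_gt0// mulr_gt0.
- by rewrite ltW// addr_gt0// mulr_gt0 ?invr_gt0// (lt_le_trans ltr01).
- exact: ltW.
(* The number of multi-indices converts [bounded_C] into [Cnorm]; the added 1 makes the constant
   positive. *)
move=> K K0 hK; exists eps0, (#|{: mindex (N - 5)}|%:R * K + 1); split=> //.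
  by rewrite ltr_wpDl// mulr_ge0.
move=> D S eps psinf ehinf sol eps_le.
have q01 t : 0 <= t -> 0 <= expR (- hubble B * t) <= 1.
  move=> t0; rewrite expR_ge0 -[leRHS]expR0 ler_expR mulNr oppr_le0.
  by rewrite mulr_ge0 ?(ltW H0).
have N54 : (N - 5 <= N - 4)%N by rewrite leq_sub2l.
pose G t x := - (along (e0 S) (sfield S) (pt t x)) ^+ 2
  + \sum_I (along (eI S I) (sfield S) (pt t x)) ^+ 2
  - (\sum_I \sum_a \sum_b einf B ehinf I a x * einf B ehinf I b x
       * pd a psinf x * pd b psinf x) * expR (- hubble B * t) ^+ 2.
have bG t : 0 <= t -> bounded_C (N - 5) (K * expR (- hubble B * t) ^+ 4) (G t).
  move=> t0; rewrite /G; under eq_fun do under eq_bigr do rewrite along_eIE.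
  apply: hK => [|||||].
  - exact: q01.
  - exact: bounded_C_le N54 (lexx _)
      (e0psi_estimate hLam ha hC0 sol eps_le t0).
  - move=> I a; exact: bounded_C_le N54 (lexx _)
      (einf_bound hN hLam ha hC0 eps0_gt0 sol eps_le I a).
  - exact: (pd_psinf_bound hN eps0_gt0 sol eps_le).
  - move=> I a; exact: bounded_C_le N54 (lexx _)
      (frame_estimate hLam ha hC0 sol eps_le I a t0).
  - move=> a; exact: (pd_sfield_estimate hN sol a t0).
split.
- apply: (@Cnorm_cvg0 R B hLam _ (#|{: mindex (N - 4)}|%:R * C0)) => t t0.
  rewrite -mulrA -(expR_natH B 2); apply: Cnorm_of_bounded_C.
  exact: (sfield_estimate sol t0).
- move=> I a; split; first by have [] := einf_bound hN hLam ha hC0 eps0_gt0 sol eps_le I a.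
  apply: (@Cnorm_cvg0 R B hLam _ (#|{: mindex (N - 4)}|%:R *
    (C0 * eps0 + (a_ini B)^-1 * flrw_coef B))) => t t0.
  rewrite -mulrA; apply: Cnorm_of_bounded_C.
  (* Multiplying the O(q^3) frame error by e^{Ht} = 1/q leaves O(q^2). *)
  have qq : expR (hubble B * t) * expR (- hubble B * t) = 1.
    by rewrite -expRD mulNr subrr expR0.
  have := bounded_CZ (expR (hubble B * t)) (frame_estimate hLam ha hC0 sol eps_le I a t0).
  congr bounded_C.
    rewrite ger0_norm ?expR_ge0// mulrCA; congr (_ * _).
    by rewrite exprS mulrA qq mul1r.
  by apply/funext => x; rewrite mulrBr mulrA qq mul1r.
- move=> t t0; apply: (@le_trans _ _ (#|{: mindex (N - 5)}|%:R *
    (K * expR (- hubble B * t) ^+ 4))%:E).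
    by rewrite (expR_natH B 2); apply: Cnorm_of_bounded_C; exact: bG.
  by rewrite lee_fin (expR_natH B 4) mulrDl mul1r mulrA lerDl exprn_ge0// expR_ge0.
move=> x nc; have s0 := einf_nondegenerate hN hLam ha hC0 eps0_gt0 sol eps_le x small nc.
set s := (X in 0 < X) in s0.
(* For t >= T one has K <= s * 2Ht < s e^{2Ht}, that is K q^2 < s. *)
exists (K / (s * (2 * hubble B))) => t tT.
have t0 : 0 <= t by apply: le_trans tT; rewrite divr_ge0// ltW// !mulr_gt0.
have [[_ dev] _ _ _ _] := sol.
rewrite (dot_grad_stmetric x dev t0).
have := (bG t t0).2 [::] x isT; rewrite /= /G.
set P := (X in X * _ ^+ 2); have -> : P = s.
  rewrite /P /s; apply: eq_bigr => I _; rewrite expr2 big_distrlr /=.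
  by apply: eq_bigr => a _; apply: eq_bigr => b _; rewrite mulrACA mulrA.
set Q := - _ + _; set q := expR (- hubble B * t).
have q0 : 0 < q by exact: expR_gt0.
(* The lower half of the order-zero estimate bounds the norm below by s q^2 - K q^4 = q^2 (s - K
   q^2). *)
rewrite ler_norml lerBrDr => /andP[+ _]; apply: lt_le_trans.
have qs : K * q ^+ 2 < s.
  have -> : q ^+ 2 = (expR (2 * hubble B * t))^-1.
    by rewrite /q -(expR_natH B 2) -expRN !mulNr.
  rewrite ltr_pdivrMr ?expR_gt0//.
  apply: (@le_lt_trans _ _ (s * (2 * hubble B * t))).
    by rewrite [leRHS]mulrA [leRHS]mulrC -ler_pdivrMr ?mulr_gt0.
  by rewrite ltr_pM2l// (lt_le_trans _ (expR_ge1Dx _))// ltrDr.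
rewrite -[4%N]/(2 + 2)%N exprD mulrA -mulNr -mulrDl mulr_gt0 ?exprn_gt0//.
by rewrite addrC subr_gt0.
Qed.
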